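(* Let $A$ and $B$ be positive definite operators on a Hilbert space $H$. If $1\geqslant r\geqslant 0$, $p>p_0\geqslant 0$, for a nonnegative integer $n$ such that $p+r=(n+1)\left((2p_0+r)+r\right)$, the following assertions are equivalent. (3-1) $A\geqslant B>0$. (3-2) $\left(A^{\frac r2}B^{p_0}A^{\frac r2}\right)^{2}\geqslant \left(A^{\frac r2}B^{p}A^{\frac r2}\right)^{\frac{1}{n+1}}$. (3-3) There exists a unique $S>0$ with $\|S\|\leqslant 1$ such that $$B^{p}=B^{p_0}A^{\frac r2}S\left(A^{\frac r2}B^{p_0}A^{r}B^{p_0}A^{\frac r2}S\right)^{n}A^{\frac r2}B^{p_0}=B^{p_0}A^{\frac r2}\left(SA^{\frac r2}B^{p_0}A^{r}B^{p_0}A^{\frac r2}\right)^{n}SA^{\frac r2}B^{p_0}.$$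
   Context: Operators are bounded linear operators on a Hilbert space $H$. An operator $X$ is positive, $X\geqslant 0$, if $\langle Xx,x\rangle\geqslant 0$ for all $x\in H$; $X\geqslant Y$ means that $X,Y$ are self-adjoint and $X-Y\geqslant 0$. $X>0$ means that $X$ is positive definite (positive and invertible). Real powers of positive definite operators are taken by the continuous functional calculus; $\|\cdot\|$ is the operator norm.
   Formalization: In the equivalence with (3-1), assertions (3-2) and (3-3) are required for all admissible r, p0, p, n; with these fixed, (3-2) does not imply (3-1) (A=1, B=2, r=0, p0=1, p=2, n=0). (3-2) and (3-3) are equivalent for each fixed choice. *)

(* Defs.v *)
From HB Require Import structures.
From mathcomp Require Import all_boot all_order all_algebra.
From mathcomp Require Import all_classical all_reals all_analysis.
From mathcomp Require Import complex.

Set Implicit Arguments.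
Unset Strict Implicit.
Unset Printing Implicit Defensive.

Import Order.TTheory GRing.Theory Num.Theory.
Import numFieldNormedType.Exports.
Local Open Scope classical_set_scope.
Local Open Scope ring_scope.
Local Open Scope complex_scope.

(* A complex Hilbert space is a [completeNormedModType R[i]] together with an
   inner product [dot : {dot H for Num.conj}] (linear in its first argument,
   conjugate-linear in the second) inducing the norm. *)
Definition induces_norm (R : realType) (H : completeNormedModType R[i])
    (dot : {dot H for (@Num.conj R[i])}) : Prop :=
  forall x, dot x x = `|x| ^+ 2.

Section Operators.
Context {R : realType} {H : completeNormedModType R[i]}.
Implicit Types (T U X : H -> H) (f : R -> R).

Definition bounded_op T : Prop := linear T /\ continuous T.

(* The norm of [H] takes its (real) values in [R[i]], hence the real part. *)
Definition opnorm T : R :=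
  sup [set complex.Re `|T x| | x in [set x : H | `|x| <= 1]].

Definition invertible_op T : Prop :=
  exists U, [/\ bounded_op U, U \o T = id & T \o U = id].

Definition spectrum T : set R[i] :=
  [set l | ~ invertible_op (fun x => T x - l *: x)].

Definition poly_op (q : {poly R}) T : H -> H :=
  fun x => \sum_(i < size q) (q`_i)%:C *: iter i T x.

(* [X] is the image [f(T)] of [f] under the continuous functional calculus of
   the self-adjoint operator [T] (whose spectrum is real): the latter is the
   extension by continuity of [q |-> poly_op q T], from the polynomials with the
   uniform norm on the spectrum to the operators with the operator norm. *)
Definition is_cfc T f X : Prop :=
  bounded_op X /\
  forall e : R, 0 < e -> exists q : {poly R},
    (forall x : R, spectrum T x%:C -> `|q.[x] - f x| <= e) /\
    opnorm (fun v => X v - poly_op q T v) <= e.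

Definition cfc T f : H -> H := get (is_cfc T f).

(* Only meant for positive definite [T]. *)
Definition op_pow T (t : R) : H -> H := cfc T (fun x => x `^ t).

Variable dot : {dot H for (@Num.conj R[i])}.

Definition self_adjoint T : Prop := forall x y, dot (T x) y = dot x (T y).

(* [0 <= z] in [R[i]] means that [z] is real and nonnegative. *)
Definition positive_op T : Prop := forall x, 0 <= dot (T x) x.

Definition op_ge T U : Prop :=
  [/\ self_adjoint T, self_adjoint U & positive_op (fun x => T x - U x)].

Definition positive_definite T : Prop :=
  [/\ bounded_op T, positive_op T & invertible_op T].

Definition admissible (r p0 p : R) (n : nat) : Prop :=
  [/\ 0 <= r <= 1, 0 <= p0 < p &
      p + r = n.+1%:R * ((2 * p0 + r) + r)].

Definition power_inequality (A B : H -> H) (r p0 p : R) (n : nat) : Prop :=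
  let Ar2 := op_pow A (r / 2) in
  op_ge (iter 2 (Ar2 \o op_pow B p0 \o Ar2))
        (op_pow (Ar2 \o op_pow B p \o Ar2) (n.+1%:R)^-1).

Definition operator_equation_solvable
    (A B : H -> H) (r p0 p : R) (n : nat) : Prop :=
  let Ar2 := op_pow A (r / 2) in
  let Ar := op_pow A r in
  let Bp0 := op_pow B p0 in
  let K := Ar2 \o Bp0 \o Ar \o Bp0 \o Ar2 in
  exists! S : H -> H,
    [/\ positive_definite S, opnorm S <= 1,
        op_pow B p = Bp0 \o Ar2 \o S \o iter n (K \o S) \o Ar2 \o Bp0 &
        op_pow B p = Bp0 \o Ar2 \o iter n (S \o K) \o S \o Ar2 \o Bp0].

End Operators.

(* Main.v *)
Require Import Defs.
From HB Require Import structures.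
From mathcomp Require Import all_boot all_order all_algebra.
From mathcomp Require Import all_classical all_reals all_analysis.
From mathcomp Require Import complex.
From mathcomp Require Import ring lra.

(** Put X = A^(r/2) B^p0 A^(r/2), Z = A^(r/2) B^p A^(r/2) and Y = Z^(1/(n+1)).
The relation between the parameters reads (p + r)/(n+1) = 2 p0 + 2 r.

From the order to the inequality.  Let G = A^(r/2) B^(p/2), with
adjoint G' = B^(p/2) A^(r/2), and W = G' G = B^(p/2) A^r B^(p/2), so that
Z = G G'.  The (n+1)-st root of G G' is G W^(-n/(n+1)) G' ([root_sandwich_swap]): this operator is positive definite
and its powers telescope, and a positive definite operator has only one
positive definite (n+1)-st root ([op_pow_root]).  If A >= B then A^r >= B^r by
the Loewner-Heinz inequality ([lowner_heinz]), hence W >= B^(p+r), and again by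
Loewner-Heinz W^(n/(n+1)) >= B^((p+r) n/(n+1)).  Inversion reverses the order
([form_ge_inv]), so that
  Y <= G B^(-(p+r) n/(n+1)) G' = A^(r/2) B^(2 p0 + r) A^(r/2)
    <= A^(r/2) B^p0 A^r B^p0 A^(r/2) = X^2.
Conversely the parameters r = 1, p0 = 0, p = 1, n = 0 turn the inequality into
A^2 >= A^(1/2) B A^(1/2), which is A >= B after cancelling A^(1/2).

From the inequality to the equation, for fixed parameters.  Multiplied by
A^(r/2) on both sides, the equation becomes (X S X)^(n+1) = Z, that is,
X S X = Y by uniqueness of roots.  So S = X^(-1) Y X^(-1) is the only candidate,
and S <= 1 amounts to Y <= X^2 ([inequality_iff_solvable]).

The functional calculus behind the powers rests on one estimate
([poly_op_spectral_bound]): for a self-adjoint T and a real polynomial q, the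
norm of q(T) is at most the supremum of |q| on the spectrum of T.  Indeed
k = ||q(T)|| makes q(T)^2 - k^2 non-invertible, and factoring q^2 - k^2 over the
complex numbers produces a spectral point of T, necessarily real, at which
|q| = k.  This gives uniqueness of f(T) and, together with Bernstein's
approximation of powers by polynomials, existence ([op_powP]).  All inverses are
obtained from Neumann series, and the semigroup law T^s T^t = T^(s+t)
([op_powD]) carries every later computation with powers. *)

Set Implicit Arguments.
Unset Strict Implicit.
Unset Printing Implicit Defensive.

Import Order.TTheory GRing.Theory Num.Theory.
Import numFieldNormedType.Exports.
Local Open Scope classical_set_scope.
Local Open Scope ring_scope.
Local Open Scope complex_scope.

(** * Polynomial approximation of real powers *)

Section Bernstein.
Context (R : realType).
Implicit Types (f g : nat -> R) (x c e : R).

(** The Bernstein polynomial sum_k f(k) 'C(n, k) X^k (1 - X)^(n - k), defined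
through Pascal's rule; this recursion makes the properties below one-line
inductions. *)
Fixpoint bern n f : {poly R} :=
  if n is n'.+1 then 'X * bern n' (fun k => f k.+1) + (1 - 'X) * bern n' f
  else (f 0%N)%:P.

Lemma bernS n f x :
  (bern n.+1 f).[x] = x * (bern n (fun k => f k.+1)).[x] + (1 - x) * (bern n f).[x].
Proof. by rewrite /= hornerD !hornerM hornerD hornerN hornerX hornerC. Qed.

Lemma bern_le n f g x : 0 <= x <= 1 -> (forall k, (k <= n)%N -> f k <= g k) ->
  (bern n f).[x] <= (bern n g).[x].
Proof.
move=> /andP[x0 x1]; elim: n f g => [|n IH] f g h; first by rewrite !hornerC h.
rewrite !bernS lerD // ler_wpM2l ?subr_ge0 //; apply: IH => k hk; apply: h => //.
exact: leqW.
Qed.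

(** The second moment of the binomial distribution, about an arbitrary centre c:
the induction needs the centre to vary, since shifting k by one shifts c. *)
Lemma bern_quadratic n (u v c x : R) : (bern n (fun k => u + v * (k%:R - c) ^+ 2)).[x] =
  u + v * (n%:R * x * (1 - x) + (n%:R * x - c) ^+ 2).
Proof.
elim: n c => [|n IH] c; first by rewrite hornerC; ring.
rewrite bernS IH (_ : (fun k => _) = (fun k => u + v * (k%:R - (c - 1)) ^+ 2)).
  by rewrite IH -natr1; ring.
by apply/funext => k; rewrite -natr1; ring.
Qed.

Lemma bernN n f x : (bern n (fun k => - f k)).[x] = - (bern n f).[x].
Proof.
elim: n f => [|n IH] f; first by rewrite !hornerC.
by rewrite !bernS !IH; ring.
Qed.

Lemma bernB n f c x : (bern n (fun k => f k - c)).[x] = (bern n f).[x] - c.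
Proof.
elim: n f => [|n IH] f; first by rewrite !hornerC.
by rewrite !bernS !IH; ring.
Qed.

(** Bernstein's proof of the Weierstrass theorem.  For a Lipschitz function the
error at the node k is at most a multiple of |d|, for d = k - N s, and the
inequality between arithmetic and geometric means bounds it by a constant plus a
multiple of d^2, whose Bernstein transform is explicit. *)
Lemma lipschitz_approx (f : R -> R) (a b L e : R) : a < b -> 0 <= L -> 0 < e ->
  (forall x y, a <= x <= b -> a <= y <= b -> `|f x - f y| <= L * `|x - y|) ->
  exists q : {poly R}, forall x, a <= x <= b -> `|q.[x] - f x| <= e.
Proof.
move=> ab L0 e0 hf.
have ba : 0 < b - a by rewrite subr_gt0.
pose K := L * (b - a).
have K0 : 0 <= K by rewrite mulr_ge0 // ltW.
(* With N = n + 1 nodes, 2 K |d| <= e (N + d^2) holds as soon as K^2 <= e^2 N. *)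
have [n hn] : exists n : nat, K ^+ 2 <= e ^+ 2 * n.+1%:R.
  exists (Num.truncn (K ^+ 2 / e ^+ 2)).
  rewrite mulrC -ler_pdivrMr ?exprn_gt0 // ltW // truncnS_gt //.
set N : R := n.+1%:R in hn.
have N0 : 0 < N by rewrite ltr0n.
exists (bern n.+1 (fun k => f (a + (b - a) * (k%:R / N))) \Po ((b - a)^-1 *: ('X - a%:P))).
move=> x /andP[ax xb]; rewrite horner_comp.
have -> : ((b - a)^-1 *: ('X - a%:P)).[x] = (b - a)^-1 * (x - a) by rewrite !hornerE.
set s := (b - a)^-1 * (x - a).
have xE : x = a + (b - a) * s by rewrite /s mulVKf ?gt_eqF // subrKC.
have s01 : 0 <= s <= 1.
  rewrite /s mulr_ge0 ?invr_ge0 ?subr_ge0 ?(ltW ab) //=.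
  by rewrite mulrC ler_pdivrMr // mul1r lerB.
clearbody s.
have main k : (k <= n.+1)%N -> `|f (a + (b - a) * (k%:R / N)) - f x| <=
    e / 2 + e / 2 / N * (k%:R - N * s) ^+ 2.
  move=> hk; have kN : 0 <= k%:R / N <= 1.
    by rewrite divr_ge0 ?ler0n ?(ltW N0) //= ler_pdivrMr // mul1r ler_nat.
  have /andP[k0 k1] := kN; have /andP[s0 s1] := s01.
  apply: (le_trans (hf _ _ _ _)); rewrite ?ax ?xb //.
    by rewrite lerDl mulr_ge0 ?(ltW ba) //= -lerBrDl ger_pMr.
  have -> : a + (b - a) * (k%:R / N) - x = (b - a) / N * (k%:R - N * s).
    rewrite xE; field; exact: lt0r_neq0.
  set d := (_ - N * s).
  rewrite normrM (ger0_norm (_ : 0 <= (b - a) / N)) ?divr_ge0 ?(ltW ba) ?(ltW N0) //.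
  rewrite -(real_normK (num_real d)); have D0 : 0 <= `|d| by exact: normr_ge0.
  move: `|d| D0 => D D0.
  have -> : L * ((b - a) / N * D) = K * D / N by rewrite /K; ring.
  have -> : e / 2 + e / 2 / N * D ^+ 2 = (e * N + e * D ^+ 2) / 2 / N.
    by field; exact: lt0r_neq0.
  rewrite ler_pM2r ?invr_gt0 // ler_pdivlMr //.
  have h1 : K ^+ 2 * D ^+ 2 * 4 <= (e * N + e * D ^+ 2) ^+ 2.
    have : K ^+ 2 * D ^+ 2 <= e ^+ 2 * N * D ^+ 2 by rewrite ler_wpM2r ?sqr_ge0.
    have : 0 <= (e * N - e * D ^+ 2) ^+ 2 by rewrite sqr_ge0.
    lra.
  rewrite -(@ler_pXn2r _ 2) ?nnegrE ?mulr_ge0 ?(ltW ba) //.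
    by move: h1; lra.
  by rewrite addr_ge0 ?mulr_ge0 ?exprn_ge0 ?(ltW e0) ?(ltW N0).
(* The variance term is N s (1 - s), and s (1 - s) <= 1. *)
have h2 : (bern n.+1 (fun k => e / 2 + e / 2 / N * (k%:R - N * s) ^+ 2)).[s] <= e.
  rewrite bern_quadratic -/N subrr expr0n addr0.
  have -> : e / 2 + e / 2 / N * (N * s * (1 - s)) = e * (1 + s * (1 - s)) / 2.
    by field; exact: lt0r_neq0.
  have /andP[s0 s1] := s01; rewrite ler_pdivrMr // ler_pM2l //.
  by have := mulr_ge0 s0 s0; lra.
rewrite -bernB ler_norml; apply/andP; split.
  rewrite lerNl -bernN (le_trans _ h2)//; apply: bern_le => // k hk.
  by rewrite (le_trans _ (main k hk))// -normrN ler_norm.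
rewrite (le_trans _ h2)//; apply: bern_le => // k hk.
by rewrite (le_trans _ (main k hk))// ler_norm.
Qed.

Lemma expR_lip (K u v : R) : u <= K -> v <= K -> `|expR u - expR v| <= expR K * `|u - v|.
Proof.
wlog vu : u v / v <= u.
  move=> h hu hv; case/orP: (le_total v u) => uv; first exact: h.
  by rewrite distrC (distrC u); exact: h.
move=> uK vK; rewrite !ger0_norm ?subr_ge0 ?ler_expR //.
have -> : expR u - expR v = expR u * (1 - expR (v - u)).
  by rewrite mulrBr mulr1 -expRD subrKC.
rewrite ler_pM ?expR_ge0 ?ler_expR ?subr_ge0 //.
  by rewrite -expR0 ler_expR subr_le0.
by have := expR_ge1Dx (v - u); lra.
Qed.

Lemma ln_lip (m x y : R) : 0 < m -> m <= x -> m <= y -> `|ln x - ln y| <= m^-1 * `|x - y|.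
Proof.
wlog yx : x y / y <= x.
  move=> h m0 hx hy; case/orP: (le_total y x) => xy; first exact: h.
  by rewrite distrC (distrC x); exact: h.
move=> m0 mx my; have y0 : 0 < y by rewrite (lt_le_trans m0).
have x0 : 0 < x by rewrite (lt_le_trans m0).
rewrite !ger0_norm ?subr_ge0 ?ler_ln ?posrE //.
rewrite -ln_div ?posrE //.
have -> : x / y = 1 + (x / y - 1) by rewrite subrKC.
rewrite (le_trans (le_ln1Dx _)) //.
  by rewrite ltrBrDl subrr divr_gt0.
have -> : x / y - 1 = y^-1 * (x - y) by field; exact: lt0r_neq0.
by rewrite ler_wpM2r ?subr_ge0 // lef_pV2 // posrE.
Qed.

Lemma powR_expR (x t : R) : 0 < x -> x `^ t = expR (t * ln x).
Proof. by move=> x0; rewrite /powR gt_eqF. Qed.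

Lemma ln_bound (m M x : R) : 0 < m -> m <= x <= M -> `|ln x| <= `|ln m| + `|ln M|.
Proof.
move=> m0 /andP[mx xM]; have x0 : 0 < x by rewrite (lt_le_trans m0).
have h1 : ln m <= ln x by rewrite ler_ln ?posrE.
have h2 : ln x <= ln M by rewrite ler_ln ?posrE // (lt_le_trans x0).
have := ler_norm (ln M); have := ler_norm (- ln m); rewrite normrN.
have := normr_ge0 (ln m); have := normr_ge0 (ln M).
rewrite (ler_norml (ln x)); lra.
Qed.

(** Both the exponential and, away from 0, the logarithm are Lipschitz, and
x^t = exp (t ln x). *)
Lemma powR_lip (m M t : R) : 0 < m -> exists2 L, 0 <= L &
  forall x y, m <= x <= M -> m <= y <= M -> `|x `^ t - y `^ t| <= L * `|x - y|.
Proof.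
move=> m0; pose K := `|t| * (`|ln m| + `|ln M|).
exists (expR K * `|t| * m^-1).
  by rewrite !mulr_ge0 ?expR_ge0 ?invr_ge0 // ltW.
have hK x : m <= x <= M -> t * ln x <= K.
  move=> hx; rewrite (le_trans (ler_norm _))// normrM ler_wpM2l //.
  exact: ln_bound hx.
move=> x y hx hy; have [/andP[mx _] /andP[my _]] := (hx, hy).
rewrite !powR_expR ?(lt_le_trans m0) //.
rewrite (le_trans (expR_lip (hK _ hx) (hK _ hy)))// -!mulrA ler_wpM2l ?expR_ge0 //.
by rewrite -mulrBr normrM ler_wpM2l // ln_lip.
Qed.

(** Continuity of the power in its exponent, uniformly for x in [m, M]; it
becomes continuity of t |-> T^t for operators. *)
Lemma powR_cont (m M t : R) (e : R) : 0 < m -> 0 < e -> exists2 d, 0 < d &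
  forall s x, `|s - t| <= d -> m <= x <= M -> `|x `^ s - x `^ t| <= e.
Proof.
move=> m0 e0; pose B := `|ln m| + `|ln M|; pose K := (`|t| + 1) * B.
have B0 : 0 <= B by rewrite addr_ge0.
have C0 : 0 < expR K * B + 1 by rewrite ltr_wpDl ?mulr_ge0 ?expR_ge0.
exists (Num.min 1 (e / (expR K * B + 1))).
  by rewrite lt_min ltr01 divr_gt0.
move=> s x; rewrite le_min => /andP[h1 h2] hx; have [/andP[mx _]] := hx.
rewrite !powR_expR ?(lt_le_trans m0) //.
have hl : `|ln x| <= B := ln_bound m0 hx.
have hK r : `|r| <= `|t| + 1 -> r * ln x <= K.
  by move=> hr; rewrite (le_trans (ler_norm _))// normrM ler_pM.
have hs : `|s| <= `|t| + 1.
  by have := ler_normD t (s - t); rewrite subrKC; lra.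
have ht : `|t| <= `|t| + 1 by rewrite lerDl.
rewrite (le_trans (expR_lip (hK _ hs) (hK _ ht)))// -mulrBl normrM.
move: h2; rewrite ler_pdivlMr // => /(le_trans _); apply.
rewrite mulrCA ler_wpM2l // (@le_trans _ _ (expR K * B)) ?lerDl //.
by rewrite ler_wpM2l ?expR_ge0.
Qed.
End Bernstein.

(** * The real inner product and linear operators *)

Section HilbertOperators.
Context (R : realType) (H : completeNormedModType R[i]).
Context (dot : {dot H for (@Num.conj R[i])}) (hdot : induces_norm dot).
Implicit Types (x y z : H) (a b c e m M : R) (T U : H -> H).

(** The real part of the inner product is a real inner product with the same norm,
and a linear operator is self-adjoint for one exactly if it is for the other.
Working with it keeps all inequalities in the ordered field R. *)
Definition ip x y : R := complex.Re (dot x y).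
Definition nrm x : R := complex.Re `|x|.

Lemma ReD (u v : R[i]) : complex.Re (u + v) = complex.Re u + complex.Re v.
Proof. by case: u v => [? ?] [? ?]. Qed.
Lemma ReN (u : R[i]) : complex.Re (- u) = - complex.Re u.
Proof. by case: u => [? ?]. Qed.
Lemma ReZ a (u : R[i]) : complex.Re (a%:C * u) = a * complex.Re u.
Proof. by case: u => [? ?] /=; rewrite mul0r subr0. Qed.
Lemma conjCcE (u : R[i]) : Num.conj u = conjc u.
Proof.
have [->|u0] := eqVneq u 0; first by rewrite !rmorph0.
by apply: (mulfI u0); rewrite -normCK sqr_normc.
Qed.

Lemma ReJ (u : R[i]) : complex.Re (Num.conj u) = complex.Re u.
Proof. by rewrite conjCcE; case: u. Qed.

Lemma nrmE x : (nrm x)%:C = `|x|.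
Proof. by rewrite /nrm RRe_real // ger0_real. Qed.

Lemma nrm_ge0 x : 0 <= nrm x.
Proof. by rewrite -ler0c nrmE. Qed.

Lemma dotC x y : dot y x = Num.conj (dot x y).
Proof. by have := hermC dot y x; rewrite /= expr0 mul1r. Qed.

Lemma ipC x y : ip x y = ip y x.
Proof. by rewrite /ip (dotC x y) ReJ. Qed.
Lemma ipDl x y z : ip (x + y) z = ip x z + ip y z.
Proof. by rewrite /ip linearDl /= ReD. Qed.
Lemma ipDr x y z : ip x (y + z) = ip x y + ip x z.
Proof. by rewrite ipC ipDl !(ipC x). Qed.
Lemma ipNl x z : ip (- x) z = - ip x z.
Proof. by rewrite /ip linearNl /= ReN. Qed.
Lemma ipNr x z : ip x (- z) = - ip x z.
Proof. by rewrite ipC ipNl ipC. Qed.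
Lemma ipZl a x z : ip (a%:C *: x) z = a * ip x z.
Proof. by rewrite /ip linearZl_LR /= ReZ. Qed.
Lemma ipZr a x z : ip x (a%:C *: z) = a * ip x z.
Proof. by rewrite ipC ipZl ipC. Qed.
Lemma ip0l x : ip 0 x = 0.
Proof. by rewrite -(scale0r 0) (_ : 0 = 0%:C) // ipZl mul0r. Qed.
Lemma ip0r x : ip x 0 = 0.
Proof. by rewrite ipC ip0l. Qed.

Definition ipE := (ipDl, ipDr, ipNl, ipNr, ipZl, ipZr).

Lemma ipxx x : ip x x = nrm x ^+ 2.
Proof. by rewrite /ip hdot -nrmE -rmorphXn. Qed.

Lemma nrm0 : nrm 0 = 0.
Proof. by rewrite /nrm normr0. Qed.
Lemma nrm_eq0 x : nrm x = 0 -> x = 0.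
Proof. by move=> h; apply/eqP; rewrite -normr_eq0 -nrmE h. Qed.
Lemma nrmN x : nrm (- x) = nrm x.
Proof. by rewrite /nrm normrN. Qed.
Lemma nrmD x y : nrm (x + y) <= nrm x + nrm y.
Proof. by rewrite -lecR rmorphD /= !nrmE ler_normD. Qed.
Lemma nrmB x y : nrm (x - y) = nrm (y - x).
Proof. by rewrite /nrm distrC. Qed.
Lemma normCc a : `|a%:C| = `|a|%:C.
Proof. by rewrite normc_def /= expr0n /= addr0 sqrtr_sqr. Qed.
Lemma nrmZ a x : nrm (a%:C *: x) = `|a| * nrm x.
Proof. by rewrite /nrm normrZ normCc ReZ. Qed.

(** Cauchy-Schwarz: expand the square of |y| x - |x| y. *)
Lemma ip_le x y : ip x y <= nrm x * nrm y.
Proof.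
have [y0|y0] := eqVneq (nrm y) 0.
  by rewrite (nrm_eq0 y0) ip0r nrm0 mulr0.
have hy : 0 < nrm y by rewrite lt0r y0 nrm_ge0.
have := nrm_ge0 x => hx.
have h : 0 <= ip ((nrm y)%:C *: x - (nrm x)%:C *: y) ((nrm y)%:C *: x - (nrm x)%:C *: y).
  by rewrite ipxx sqr_ge0.
rewrite !ipE !ipxx (ipC y x) in h.
have [x0|x0] := eqVneq (nrm x) 0.
  by rewrite (nrm_eq0 x0) ip0l nrm0 mul0r.
have hx' : 0 < nrm x by rewrite lt0r x0 nrm_ge0.
have hh : 0 <= (nrm x * nrm y) * (nrm x * nrm y - ip x y) by nra.
by rewrite pmulr_rge0 ?subr_ge0 // ?mulr_gt0 in hh.
Qed.

Lemma ip_ge x y : - (nrm x * nrm y) <= ip x y.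
Proof. by rewrite lerNl -ipNl -(nrmN x) ip_le. Qed.

Lemma ip_sep x y : (forall z, ip x z = ip y z) -> x = y.
Proof.
move=> h; apply/eqP; rewrite -subr_eq0; apply/eqP; apply: nrm_eq0.
by apply/eqP; rewrite -sqrf_eq0 -ipxx ipDl ipNl h subrr.
Qed.

Lemma dot_sep x y : (forall z, dot x z = dot y z) -> x = y.
Proof. by move=> h; apply: ip_sep => z; rewrite /ip h. Qed.
Lemma dotDl x y z : dot (x + y) z = dot x z + dot y z.
Proof. exact: linearDl. Qed.
Lemma dotNl x z : dot (- x) z = - dot x z.
Proof. exact: linearNl. Qed.
Lemma dotZl (k : R[i]) x z : dot (k *: x) z = k * dot x z.
Proof. by rewrite linearZl_LR. Qed.
Definition dotE := (dotDl, dotNl, dotZl).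

Section Lin.
Context (T : H -> H) (hT : linear T).
Lemma linD x y : T (x + y) = T x + T y.
Proof. by have := hT 1 x y; rewrite !scale1r. Qed.
Lemma lin0 : T 0 = 0.
Proof. by apply: (addrI (T 0)); rewrite -linD !addr0. Qed.
Lemma linZ (a : R[i]) x : T (a *: x) = a *: T x.
Proof. by have := hT a x 0; rewrite lin0 !addr0. Qed.
Lemma linN x : T (- x) = - T x.
Proof. by rewrite -scaleN1r linZ scaleN1r. Qed.
Lemma linB x y : T (x - y) = T x - T y.
Proof. by rewrite linD linN. Qed.
End Lin.

Lemma lin_comp T U : linear T -> linear U -> linear (T \o U).
Proof. by move=> hT hU a x y; rewrite /= hU hT. Qed.
Lemma lin_sub T U : linear T -> linear U -> linear (fun x => T x - U x).
Proof. by move=> hT hU a x y; rewrite /= hU hT scalerBr opprD addrACA. Qed.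
Lemma lin_add T U : linear T -> linear U -> linear (fun x => T x + U x).
Proof. by move=> hT hU a x y; rewrite /= hU hT scalerDr addrACA. Qed.
Lemma lin_scale (c : R[i]) T : linear T -> linear (fun x => c *: T x).
Proof. by move=> hT a x y; rewrite hT scalerDr !scalerA mulrC. Qed.
Lemma lin_id : linear (@id H).
Proof. by []. Qed.
Lemma lin_iter n T : linear T -> linear (iter n T).
Proof. by move=> hT; elim: n => [//|n IH] a x y; rewrite !iterS IH hT. Qed.

Definition opbound T a := forall x, nrm (T x) <= a * nrm x.

Lemma bounded_opbound T : bounded_op T -> exists2 M : R, 0 < M & opbound T M.
Proof.
case=> hT cT.
pose f : {linear H -> H} := HB.pack T (GRing.isLinear.Build _ _ _ _ T hT).
have /linear_bounded_continuous/linear_boundedP : continuous f by [].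
case/pinfty_ex_gt0 => M M0 hM.
have [M' eM] : exists M', M = M'%:C.
  by exists (complex.Re M); rewrite RRe_real // gtr0_real.
exists M'; first by rewrite -ltcR -eM.
by move=> x; rewrite -lecR rmorphM /= !nrmE -eM; exact: hM.
Qed.

(** With [bounded_opbound], continuity is traded for a numerical bound, the form
in which boundedness is used everywhere below. *)
Lemma opbound_bounded T M : linear T -> opbound T M -> bounded_op T.
Proof.
move=> hT hM; split=> //.
pose f : {linear H -> H} := HB.pack T (GRing.isLinear.Build _ _ _ _ T hT).
have : continuous f; last by [].
apply/linear_bounded_continuous/bounded_funP => r.
exists (`|M|%:C * `|r|) => x xr; rewrite -nrmE.
apply: (@le_trans _ _ (`|M| * nrm x)%:C).
  rewrite lecR (le_trans (hM x))// ler_wpM2r ?nrm_ge0 // ler_norm //.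
rewrite rmorphM /= ler_wpM2l ?ler0c // nrmE (le_trans xr)// real_ler_norm //.
by apply: ger0_real; rewrite (le_trans _ xr).
Qed.

(** The norm of H takes its values in R[i]; the gauge of a Cauchy filter is
converted here, once, to positive elements of R. *)
Lemma nrm_cauchy_cvg (u : nat -> H) :
  (forall e : R, 0 < e -> exists N, forall m n : nat, (N <= m)%N -> (N <= n)%N ->
     nrm (u m - u n) <= e) ->
  exists l, forall e : R, 0 < e -> exists N, forall n, (N <= n)%N ->
     nrm (u n - l) <= e.
Proof.
move=> hu.
have /cauchy_cvgP/cvg_ex [l /= hl] : cauchy (u @ \oo).
  apply/cauchyP => e e0.
  have ee : e = (complex.Re e)%:C by rewrite RRe_real // gtr0_real.
  have e0' : 0 < complex.Re e by rewrite -ltcR -ee.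
  have [|N hN] := hu (complex.Re e / 2); first by rewrite divr_gt0.
  exists (u N); exists N => // n /= Nn.
  rewrite /= -ball_normE /= -nrmE ee ltcR.
  by rewrite (le_lt_trans (hN _ _ _ _)) // ltr_pdivrMr // ltr_pMr // ltr1n.
exists l => e e0.
have /cvgrPdist_le/(_ e%:C) := hl; rewrite ltcR => /(_ e0) [N _ hN].
by exists N => n /hN /=; rewrite -nrmE lecR nrmB.
Qed.

(** The supremum over the unit ball controls all vectors by homogeneity. *)
Lemma opnorm_leP T (a : R) : 0 <= a -> bounded_op T -> opnorm T <= a <-> opbound T a.
Proof.
move=> a0 hb; have [hT _] := hb; have [M M0 hM] := bounded_opbound hb.
set S := [set complex.Re `|T x| | x in [set x : H | `|x| <= 1]].
have hS : has_sup S.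
  split; first by exists (nrm (T 0)); exists 0 => //=; rewrite normr0.
  exists M => _ [x /= x1 <-]; rewrite (le_trans (hM x)) //.
  by rewrite ler_piMr ?(ltW M0) // -lecR nrmE.
split=> h.
- move=> x; have [x0|x0] := eqVneq (nrm x) 0.
    by rewrite (nrm_eq0 x0) lin0 // nrm0 mulr0.
  have xp : 0 < nrm x by rewrite lt0r x0 nrm_ge0.
  have : nrm (T ((nrm x)^-1%:C *: x)) <= a.
    apply: le_trans h; apply: ub_le_sup; first exact: hS.2.
    exists ((nrm x)^-1%:C *: x) => //=.
    by rewrite -nrmE nrmZ ger0_norm ?invr_ge0 ?nrm_ge0 // mulVf.
  rewrite linZ // nrmZ ger0_norm ?invr_ge0 ?nrm_ge0 //.
  by rewrite mulrC ler_pdivrMr.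
- apply: ge_sup; first exact: hS.1.
  move=> _ [x /= x1 <-]; rewrite (le_trans (h x)) // ler_piMr //.
  by rewrite -lecR nrmE.
Qed.

(** * Form bounds, inverses and the spectrum *)

Definition form_sym T := forall x y, ip (T x) y = ip x (T y).

Lemma Im_dot x y : complex.Im (dot x y) = - ip ('i%C *: x) y.
Proof. by rewrite /ip linearZl_LR /= mulrC ReiNIm opprK. Qed.

Lemma form_sym_self_adjoint T : linear T -> form_sym T -> self_adjoint dot T.
Proof.
move=> hT sT x y; apply/eqP; rewrite eq_complex -!/(ip _ _) sT eqxx /=.
by rewrite !Im_dot -(linZ hT) sT.
Qed.

(** Over the complex numbers a positive operator is self-adjoint, by polarization:
the form being real at x + i y gives the symmetry of its real part. *)
Lemma positive_opP T : linear T ->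
  positive_op dot T <-> form_sym T /\ forall x, 0 <= ip (T x) x.
Proof.
move=> hT; split=> [h|[sT h] x].
- split=> [x y|x]; last by have := h x; rewrite lecE => /andP[].
  have := h (x + 'i%C *: y); move/ger0_Im.
  rewrite Im_dot (linD hT) (linZ hT) !scalerDr !scalerA -expr2 sqr_i scaleN1r.
  rewrite !ipE => e1.
  have := ger0_Im (h x); rewrite Im_dot => e2.
  have := ger0_Im (h y); rewrite Im_dot => e3.
  have e4 : ip (T y) ('i%C *: y) = - ip ('i%C *: T y) y.
    rewrite /ip linearZr_LR linearZl_LR /= conjCcE /= -ReN; congr complex.Re.
    by rewrite -mulNr; congr (_ * _); apply/eqP; rewrite eq_complex /= oppr0 !eqxx.
  have e5 : ip ('i%C *: T x) ('i%C *: y) = ip (T x) y.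
    rewrite /ip linearZr_LR linearZl_LR /= conjCcE /= mulrA; congr complex.Re.
    rewrite -[RHS]mul1r; congr (_ * _); apply/eqP; rewrite eq_complex /=.
    by apply/andP; split; apply/eqP; ring.
  by rewrite (ipC x); lra.
- rewrite lecE -/(ip _ _) h andbT.
  have := form_sym_self_adjoint hT sT x x; rewrite (dotC (T x) x) conjCcE.
  by case: (dot _ _) => u v /= [e]; apply/eqP; lra.
Qed.

(** m <= T <= M in the order of self-adjoint operators. *)
Definition form_between T m M := [/\ linear T, form_sym T, forall x, m * nrm x ^+ 2 <= ip (T x) x
  & forall x, ip (T x) x <= M * nrm x ^+ 2].

(** Polarization: 4 <Tx, y> = <T(x+y), x+y> - <T(x-y), x-y>, at a vector y parallel
to T x and as long as x. *)
Lemma form_between_opbound T c : 0 <= c -> form_between T (- c) c -> opbound T c.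
Proof.
move=> c0 [hT sT h1 h2] x.
have [x0|x0] := eqVneq (nrm x) 0; first by rewrite (nrm_eq0 x0) lin0 // nrm0 mulr0.
have [y0|y0] := eqVneq (nrm (T x)) 0; first by rewrite y0 mulr_ge0 ?nrm_ge0.
have xp : 0 < nrm x by rewrite lt0r x0 nrm_ge0.
have yp : 0 < nrm (T x) by rewrite lt0r y0 nrm_ge0.
(* The vector y is T x rescaled to the length of x. *)
have [y ny ixy] : exists2 y, nrm y = nrm x & ip (T x) y = nrm x * nrm (T x).
  exists ((nrm x / nrm (T x))%:C *: T x).
    by rewrite nrmZ ger0_norm ?divr_ge0 ?nrm_ge0 // divfK.
  by rewrite ipZr ipxx expr2 mulrA divfK.
have := h2 (x + y); have := h1 (x - y).
rewrite -!ipxx (linB hT) (linD hT) !ipE (sT y x) (ipC y (T x)) (ipC y x) !ipxx ny ixy.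
nra.
Qed.

(** T^2 <= c T for 0 <= T <= c, because
c T (c - T) = T (c - T) T + (c - T) T (c - T). *)
Lemma form_between_sqr T c x : 0 < c -> form_between T 0 c -> nrm (T x) ^+ 2 <= c * ip (T x) x.
Proof.
move=> c0 [hT sT h1 h2].
have := h1 (c%:C *: x - T x); have := h2 (T x).
rewrite (linB hT) (linZ hT) -!ipxx !ipE mul0r (sT (T x) x) !ipxx => a1 a2.
have hh : 0 <= c * (c * ip (T x) x - nrm (T x) ^+ 2) by nra.
by rewrite pmulr_rge0 ?subr_ge0 // in hh.
Qed.

Lemma bounded_comp T U : bounded_op T -> bounded_op U -> bounded_op (T \o U).
Proof.
move=> bT bU; have [M M0 hM] := bounded_opbound bT; have [K K0 hK] := bounded_opbound bU.
apply: (@opbound_bounded _ (M * K)); first exact: lin_comp bT.1 bU.1.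
by move=> x; rewrite (le_trans (hM _)) // -mulrA ler_wpM2l // ltW.
Qed.

Lemma bounded_sub T U : bounded_op T -> bounded_op U -> bounded_op (fun x => T x - U x).
Proof.
move=> bT bU; have [M M0 hM] := bounded_opbound bT; have [K K0 hK] := bounded_opbound bU.
apply: (@opbound_bounded _ (M + K)); first exact: lin_sub bT.1 bU.1.
by move=> x; rewrite (le_trans (nrmD _ _)) // nrmN mulrDl lerD.
Qed.

Lemma bounded_id : bounded_op (@id H).
Proof. by apply: (@opbound_bounded _ 1) => // x; rewrite mul1r. Qed.

Lemma bounded_scale (k : R[i]) T : bounded_op T -> bounded_op (fun x => k *: T x).
Proof.
move=> bT; have [M M0 hM] := bounded_opbound bT.
apply: (@opbound_bounded _ (complex.Re `|k| * M)); first exact: lin_scale bT.1.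
move=> x; rewrite {1}/nrm normrZ.
have [c c0 ->] : exists2 c : R, 0 <= c & `|k| = c%:C.
  by exists (complex.Re `|k|); rewrite -?ler0c RRe_real ?ger0_real.
by rewrite -nrmE -rmorphM /= -mulrA ler_wpM2l.
Qed.

Lemma bij_invertible T m : linear T -> 0 < m -> (forall x, m * nrm x <= nrm (T x)) ->
  (forall y, exists x, T x = y) -> invertible_op T.
Proof.
move=> hT m0 hm hs.
have inj x y : T x = T y -> x = y.
  move=> e; apply/eqP; rewrite -subr_eq0; apply/eqP/nrm_eq0/le_anti.
  by have := hm (x - y); rewrite (linB hT) e subrr nrm0 pmulr_rle0 // nrm_ge0 andbT.
have /choice [U hU] := hs.
have UT : U \o T = id by apply/funext => x; apply: inj => /=; rewrite hU.
have TU : T \o U = id by apply/funext => x /=; rewrite hU.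
exists U; split=> //.
apply: (@opbound_bounded _ m^-1).
  by move=> a x y; apply: inj; rewrite hT !hU.
by move=> x; rewrite mulrC ler_pdivlMr // mulrC -{2}(hU x) hm.
Qed.

Lemma invertible_surj T : invertible_op T -> forall y, exists x, T x = y.
Proof. by case=> U [_ _ h] y; exists (U y); rewrite -[LHS]/((T \o U) y) h. Qed.

Lemma invertible_below T : invertible_op T -> exists2 m, 0 < m & forall x, m * nrm x <= nrm (T x).
Proof.
case=> U [/bounded_opbound[M M0 hM] h _]; exists M^-1; first by rewrite invr_gt0.
by move=> x; rewrite mulrC ler_pdivrMr // mulrC -{1}[x]/(id x) -h hM.
Qed.

(** The Neumann series y + T y + T^2 y + ... solves x - T x = y. *)
Lemma neumann_surj T c : linear T -> 0 <= c -> c < 1 -> opbound T c ->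
  forall y, exists x, x - T x = y.
Proof.
move=> hT c0 c1 hc y.
pose u k := \sum_(i < k) iter i T y.
have uS k : u k.+1 = y + T (u k).
  rewrite /u big_ord_recl /=; congr (_ + _).
  by elim: k => [|k IH]; rewrite ?big_ord0 ?(lin0 hT) // !big_ord_recr /= (linD hT) IH.
have hiter k : nrm (iter k T y) <= c ^+ k * nrm y.
  elim: k => [|k IH]; first by rewrite expr0 mul1r.
  by rewrite iterS (le_trans (hc _))// exprS -mulrA ler_wpM2l.
(* Multiplied by 1 - c, the geometric sum telescopes. *)
have hdiff N k : nrm (u (N + k)%N - u N) * (1 - c) <= c ^+ N * nrm y.
  suff : nrm (u (N + k)%N - u N) * (1 - c) <= (c ^+ N - c ^+ (N + k)) * nrm y.
    move=> h; rewrite (le_trans h)// ler_wpM2r ?nrm_ge0 // gerBl exprn_ge0 //.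
  elim: k => [|k IH]; first by rewrite addn0 !subrr nrm0 !mul0r.
  rewrite addnS /u big_ord_recr -/(u _) /= addrAC.
  have := nrmD (u (N + k)%N - u N) (iter (N + k) T y).
  have := hiter (N + k)%N; rewrite exprS; nra.
have cc : 0 < 1 - c by rewrite subr_gt0.
have [|l hl] := @nrm_cauchy_cvg u.
  move=> e e0.
  have y1 : 0 < nrm y + 1 by rewrite ltr_wpDl ?nrm_ge0.
  have [N hN] : exists N, c ^+ N * (nrm y + 1) <= e * (1 - c) / 2.
    have /cvgrPdist_le/(_ (e * (1 - c) / 2 / (nrm y + 1))) : GRing.exp c @ \oo --> 0.
      by apply: cvg_expr; rewrite ger0_norm.
    case; first by rewrite !divr_gt0 ?mulr_gt0.
    move=> N _ /(_ N (leqnn N)); rewrite /= sub0r normrN ger0_norm ?exprn_ge0 //.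
    by rewrite ler_pdivlMr //; exists N.
  exists N.
  have hn n : (N <= n)%N -> nrm (u n - u N) <= e / 2.
    move=> Nn; have := hdiff N (n - N)%N; rewrite subnKC // => h.
    rewrite -(ler_pM2r cc) (le_trans h)// mulrAC (le_trans _ hN)//.
    by rewrite ler_wpM2l ?exprn_ge0 // lerDl.
  move=> m n /hn hm /hn {}hn.
  have -> : u m - u n = (u m - u N) - (u n - u N) by rewrite opprB addrA subrK.
  by rewrite (le_trans (nrmD _ _))// nrmN; lra.
exists l; apply/eqP; rewrite -subr_eq0; apply/eqP/nrm_eq0/le_anti.
rewrite nrm_ge0 andbT; apply/ler_addgt0Pl => e e0; rewrite addr0.
have [|N hN] := hl (e / 2); first by rewrite divr_gt0.
have -> : l - T l - y = T (u N - l) - (u N.+1 - l).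
  by apply: ip_sep => z; rewrite uS (linB hT) !ipE; ring.
rewrite (le_trans (nrmD _ _))// nrmN.
have := hN N.+1 (leqnSn _); have := hN N (leqnn _); have := hc (u N - l).
have := nrm_ge0 (u N - l); nra.
Qed.

Lemma form_between_scale T m M a : 0 <= a -> form_between T m M -> form_between (fun x => a%:C *: T x) (a * m) (a * M).
Proof.
move=> a0 [hT sT h1 h2]; split.
- exact: lin_scale.
- by move=> x y; rewrite !ipE sT.
- by move=> x; rewrite !ipE -mulrA ler_wpM2l.
- by move=> x; rewrite !ipE -mulrA ler_wpM2l.
Qed.

Lemma form_between_shift T m M a : form_between T m M -> form_between (fun x => T x - a%:C *: x) (m - a) (M - a).
Proof.
move=> [hT sT h1 h2]; split.
- by apply: lin_sub => //; exact: (lin_scale _ lin_id).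
- by move=> x y; rewrite !ipE sT.
- by move=> x; rewrite !ipE ipxx mulrBl lerD2r.
- by move=> x; rewrite !ipE ipxx mulrBl lerD2r.
Qed.

Lemma form_between_opp T m M : form_between T m M -> form_between (fun x => - T x) (- M) (- m).
Proof.
move=> [hT sT h1 h2]; split.
- by move=> c x y; rewrite hT opprD scalerN.
- by move=> x y; rewrite !ipE sT.
- by move=> x; rewrite !ipE mulNr lerN2.
- by move=> x; rewrite !ipE mulNr lerN2.
Qed.

Lemma form_between_weaken T m M m' M' : m' <= m -> M <= M' -> form_between T m M -> form_between T m' M'.
Proof.
move=> hm hM [hT sT h1 h2]; split=> // x.
- by rewrite (le_trans _ (h1 x))// ler_wpM2r ?sqr_ge0.
- by rewrite (le_trans (h2 x))// ler_wpM2r ?sqr_ge0.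
Qed.

Lemma form_between_bounded T m M : form_between T m M -> bounded_op T.
Proof.
move=> h; have [hT _ _ _] := h.
apply: (@opbound_bounded _ (`|m| + `|M|)) => //.
apply: form_between_opbound; first by rewrite addr_ge0.
apply: form_between_weaken h.
  by have := ler_norm (- m); have := normr_ge0 M; rewrite normrN; lra.
by have := ler_norm M; have := normr_ge0 m; lra.
Qed.

Lemma bounded_form_between T : bounded_op T -> form_sym T -> exists M, form_between T (- M) M.
Proof.
move=> bT sT; have [hT _] := bT; have [M M0 hM] := bounded_opbound bT.
exists M; split=> // x; have := hM x; have := nrm_ge0 x.
  have := ip_ge (T x) x; nra.
have := ip_le (T x) x; nra.
Qed.

(** 0 <= 1 - S/K < 1 for a large constant K, so the Neumann series inverts S. *)
Lemma pos_invertible T m M : 0 < m -> form_between T m M -> invertible_op T.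
Proof.
move=> m0 h; have [hT sT h1 h2] := h.
(* On the zero space M may be smaller than m, hence the maximum. *)
pose K := Num.max m M; have K0 : 0 < K by rewrite lt_max m0.
have hW : form_between (fun x => x - K^-1%:C *: T x) 0 (1 - K^-1 * m).
  have := form_between_opp (form_between_shift 1 (form_between_scale (ltW (_ : 0 < K^-1)) h)); rewrite invr_gt0 => /(_ K0).
  rewrite !opprB; set f := (fun x => _); have -> : f = (fun x => x - K^-1%:C *: T x).
    by apply/funext => x; rewrite /f opprB scale1r.
  apply: form_between_weaken => //; rewrite subr_ge0 mulrC ler_pdivrMr // mul1r.
  by rewrite le_max lexx orbT.
have cK : 0 <= 1 - K^-1 * m.
  by rewrite subr_ge0 mulrC ler_pdivrMr // mul1r le_max lexx.
apply: (bij_invertible hT m0).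
  move=> x; have [x0|x0] := eqVneq (nrm x) 0; first by rewrite x0 mulr0 nrm_ge0.
  have xp : 0 < nrm x by rewrite lt0r x0 nrm_ge0.
  by rewrite -(ler_pM2r xp) (le_trans _ (ip_le _ _))// -mulrA -expr2 h1.
move=> y; have [hl _ _ _] := hW.
have [||x hx] := @neumann_surj _ _ hl cK _ _ (K^-1%:C *: y).
- by rewrite ltrBlDr ltrDl mulr_gt0 // invr_gt0.
- by apply: form_between_opbound => //; apply: form_between_weaken hW => //; rewrite oppr_le0.
exists x; move: hx; rewrite subKr => /(congr1 ( *:%R K%:C)).
by rewrite !scalerA -rmorphM mulfV ?gt_eqF // !scale1r.
Qed.

(** For l = a + i b, the product of T - l with its commuting partner
T - (a - i b) is (T - a)^2 + b^2 >= b^2, which is invertible if b is not 0. *)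
Lemma spectrum_real T m M (l : R[i]) : form_between T m M -> spectrum T l -> l = (complex.Re l)%:C.
Proof.
move=> h sl; have [hT sT _ _] := h; apply: contrapT => hl; apply: sl.
have {hl} b0 : complex.Im l != 0.
  by apply/eqP => b0; apply: hl; apply/eqP; rewrite eq_complex b0 !eqxx.
set a := complex.Re l; set b := complex.Im l.
have hs := form_between_shift a h; set V := (fun x => T x - a%:C *: x) in hs.
have [hV sV _ _] := hs.
have [K K0 hK] := bounded_opbound (form_between_bounded hs).
have hS : form_between (fun x => V (V x) + (b ^+ 2)%:C *: x) (b ^+ 2) (K ^+ 2 + b ^+ 2).
  split.
  - apply: lin_add; first exact: lin_comp.
    exact: (lin_scale _ lin_id).
  - by move=> x y; rewrite ipDl ipDr ipZl ipZr !sV.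
  - by move=> x; rewrite ipDl ipZl sV !ipxx lerDr sqr_ge0.
  - move=> x; rewrite ipDl ipZl sV !ipxx mulrDl lerD2r -exprMn.
    by rewrite ler_pXn2r ?nnegrE ?mulr_ge0 ?nrm_ge0 // ltW.
have b2 : 0 < b ^+ 2 by rewrite exprn_even_gt0.
have iS := pos_invertible b2 hS.
have el : l = a%:C + 'i%C * b%:C by rewrite -complexE.
have lin1 : linear (fun x => T x - l *: x).
  by apply: lin_sub => //; exact: (lin_scale _ lin_id).
have eb2 : (b ^+ 2)%:C = - ('i%C * b%:C) ^+ 2.
  by rewrite exprMn sqr_i mulN1r opprK rmorphXn.
(* L is T minus the conjugate of l. *)
pose L x := T x - (a%:C - 'i%C * b%:C) *: x.
have eS1 x : V (V x) + (b ^+ 2)%:C *: x = (T (L x) - l *: L x).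
  rewrite /V /L !(linB hT) !(linZ hT) el eb2.
  by apply: dot_sep => z; rewrite !dotE; ring.
have eS2 x : V (V x) + (b ^+ 2)%:C *: x = L (T x - l *: x).
  rewrite /V /L !(linB hT) !(linZ hT) el eb2.
  by apply: dot_sep => z; rewrite !dotE; ring.
have [m' m'0 hm'] := invertible_below iS.
have hL : linear L by apply: lin_sub => //; exact: (lin_scale _ lin_id).
have [K' K'0 hK'] : exists2 K', 0 < K' & opbound L K'.
  apply: bounded_opbound; apply: bounded_sub; first exact: form_between_bounded h.
  exact: bounded_scale bounded_id.
apply: (@bij_invertible _ (m' / K')) => //; first by rewrite divr_gt0.
- move=> x; rewrite mulrAC ler_pdivrMr // [leRHS]mulrC (le_trans (hm' x))//.
  rewrite eS2; exact: hK'.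
- move=> y; have [x hx] := invertible_surj iS y.
  by exists (L x); rewrite -eS1.
Qed.

Lemma invertible_opp T : linear T -> invertible_op (fun x => - T x) -> invertible_op T.
Proof.
move=> hT [U [bU h1 h2]]; exists (fun x => - U x); split.
- by have := bounded_scale (-1) bU; under eq_fun do rewrite scaleN1r.
- apply/funext => x; have := congr1 (@^~ x) h1; rewrite /= => {2}<-.
  by rewrite (linN bU.1).
- by apply/funext => x; have := congr1 (@^~ x) h2; rewrite /= => {2}<-; rewrite (linN hT).
Qed.

Lemma spectrum_itv T m M (l : R) : form_between T m M -> spectrum T l%:C -> m <= l <= M.
Proof.
move=> h sl; apply/andP; split; rewrite leNgt; apply/negP => hl; apply: sl.
  by apply: pos_invertible (form_between_shift l h); rewrite subr_gt0.
have hs := form_between_shift l h; have [hT _ _ _] := hs.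
apply: (invertible_opp hT); apply: (pos_invertible _ (form_between_opp hs)).
by rewrite opprB subr_gt0.
Qed.

(** * Polynomials in an operator *)

(** [poly_op] for complex coefficients, which are needed to split a real
polynomial into linear factors. *)
Definition cpoly (q : {poly R[i]}) T x : H := \sum_(i < size q) q`_i *: iter i T x.

Lemma cpoly_widen n (q : {poly R[i]}) T x : (size q <= n)%N ->
  cpoly q T x = \sum_(i < n) q`_i *: iter i T x.
Proof.
move=> h; rewrite /cpoly (big_ord_widen n (fun i => q`_i *: iter i T x) h).
rewrite big_mkcond /=; apply: eq_bigr => i _; case: ltnP => // hi.
by rewrite nth_default // scale0r.
Qed.

Lemma poly_op_cpoly (q : {poly R}) T : poly_op q T = cpoly (map_poly (real_complex R) q) T.
Proof.
apply/funext => x; rewrite (@cpoly_widen (size q)) ?size_poly //.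
by apply: eq_bigr => i _; rewrite coef_map.
Qed.

Lemma cpolyD p q T x : cpoly (p + q) T x = cpoly p T x + cpoly q T x.
Proof.
set n := maxn (size p) (size q).
rewrite (@cpoly_widen n) ?size_polyD // (@cpoly_widen n) ?leq_maxl //.
rewrite (@cpoly_widen n q) ?leq_maxr // -big_split; apply: eq_bigr => i _ /=.
by rewrite coefD scalerDl.
Qed.

Lemma cpolyZ k q T x : cpoly (k *: q) T x = k *: cpoly q T x.
Proof.
rewrite (@cpoly_widen (size q)) ?size_scale_leq // /cpoly scaler_sumr.
by apply: eq_bigr => i _; rewrite coefZ scalerA.
Qed.

Lemma cpoly0 T x : cpoly 0 T x = 0.
Proof. by rewrite /cpoly size_poly0 big_ord0. Qed.

Lemma cpolyC k T x : cpoly k%:P T x = k *: x.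
Proof. by rewrite (@cpoly_widen 1) ?size_polyC_leq1 // big_ord1 coefC. Qed.

Lemma cpolyMX q T x : linear T -> cpoly (q * 'X) T x = T (cpoly q T x).
Proof.
move=> hT; rewrite (@cpoly_widen (size q).+1) ?(leq_trans (size_polyMleq _ _)) ?size_polyX ?addn2 //.
rewrite big_ord_recl coefMX /= scale0r add0r.
pose f : {linear H -> H} := HB.pack T (GRing.isLinear.Build _ _ _ _ T hT).
rewrite -[T (cpoly _ _ _)]/(f (cpoly _ _ _)) /cpoly linear_sum /=.
by apply: eq_bigr => i _; rewrite coefMX /= (linZ hT).
Qed.

Lemma cpolyX T x : linear T -> cpoly 'X T x = T x.
Proof. by move=> hT; rewrite -['X]mul1r cpolyMX // cpolyC scale1r. Qed.

Lemma cpolyM p q T x : linear T -> cpoly (p * q) T x = cpoly p T (cpoly q T x).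
Proof.
move=> hT; elim/poly_ind: p x => [|p k IH] x; first by rewrite mul0r !cpoly0.
rewrite mulrDl -mulrA ['X * q]mulrC mulrA mul_polyC !cpolyD cpolyZ cpolyC.
by rewrite !cpolyMX // IH.
Qed.

Lemma bounded_add T U : bounded_op T -> bounded_op U -> bounded_op (fun x => T x + U x).
Proof.
move=> bT bU; have := bounded_sub bT (bounded_scale (-1) bU).
by under eq_fun do rewrite scaleN1r opprK.
Qed.

Lemma bounded_cpoly q T : bounded_op T -> bounded_op (cpoly q T).
Proof.
move=> bT; have [hT _] := bT; elim/poly_ind: q => [|q k IH].
  rewrite (_ : cpoly 0 T = (fun x => 0 *: x)); first exact: bounded_scale bounded_id.
  by apply/funext => x; rewrite cpoly0 scale0r.
rewrite (_ : cpoly _ T = (fun x => (T \o cpoly q T) x + k *: x)).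
  exact: bounded_add (bounded_comp bT IH) (bounded_scale k bounded_id).
by apply/funext => x; rewrite cpolyD cpolyMX // cpolyC.
Qed.

Lemma invertible_comp T U : invertible_op T -> invertible_op U -> invertible_op (T \o U).
Proof.
case=> T' [bT h1 h2] [U' [bU h3 h4]]; exists (U' \o T'); split.
- exact: bounded_comp.
- apply/funext => x /=; rewrite -[T' _]/((T' \o T) _) h1.
  exact: (congr1 (@^~ x) h3).
- apply/funext => x /=; rewrite -[U _]/((U \o U') _) h4.
  exact: (congr1 (@^~ x) h2).
Qed.

(** Half of the spectral mapping theorem: a product of invertible
linear factors is invertible. *)
Lemma invertible_cpoly q T : bounded_op T -> q != 0 ->
  (forall l, root q l -> ~ spectrum T l) -> invertible_op (cpoly q T).
Proof.
move=> bT q0 hq; have [hT _] := bT.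
have [rs e] := closed_field_poly_normal q.
have {}hq : forall l, l \in rs -> invertible_op (fun x => T x - l *: x).
  move=> l lr; apply: contrapT; apply: hq.
  by rewrite e rootZ ?lead_coef_eq0 // root_prod_XsubC.
rewrite e; elim: rs {e} hq => [|l rs IH] hq.
  rewrite big_nil alg_polyC; exists (fun x => (lead_coef q)^-1 *: x); split.
  - exact: bounded_scale bounded_id.
  - by apply/funext => x /=; rewrite cpolyC scalerA mulVf ?lead_coef_eq0 // scale1r.
  - by apply/funext => x /=; rewrite cpolyC scalerA mulfV ?lead_coef_eq0 // scale1r.
have -> : cpoly (lead_coef q *: \prod_(z <- l :: rs) ('X - z%:P)) T =
   (fun x => T x - l *: x) \o cpoly (lead_coef q *: \prod_(z <- rs) ('X - z%:P)) T.
  apply/funext => x; rewrite big_cons scalerAr cpolyM //= -polyCN cpolyD cpolyC.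
  by rewrite cpolyX // scaleNr.
apply: invertible_comp; first by apply: hq; rewrite mem_head.
by apply: IH => z zr; apply: hq; rewrite in_cons zr orbT.
Qed.

Lemma opnorm_ge0 T : bounded_op T -> 0 <= opnorm T.
Proof.
move=> bT; have [M M0 hM] := bounded_opbound bT.
apply: ub_le_sup; last by exists 0; rewrite /= ?normr0 ?(lin0 bT.1) ?normr0.
exists M => _ [x /= x1 <-]; rewrite (le_trans (hM x)) //.
by rewrite ler_piMr ?(ltW M0) // -lecR nrmE.
Qed.

Lemma opbound_opnorm T : bounded_op T -> opbound T (opnorm T).
Proof. by move=> bT; apply/opnorm_leP => //; exact: opnorm_ge0. Qed.

(** With k the norm of T, a lower bound m |x| <= |T^2 x - k^2 x| would give
k^2 |T x|^2 <= (k^4 - m^2) |x|^2 after expanding the square, a bound on T that is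
smaller than k. *)
Lemma opnorm_sqr_not_regular T x0 : bounded_op T -> form_sym T -> nrm x0 != 0 ->
  ~ invertible_op (fun x => T (T x) - (opnorm T ^+ 2)%:C *: x).
Proof.
move=> bT sT x00 iT; have hk := opbound_opnorm bT; have k0 := opnorm_ge0 bT.
set k := opnorm T in iT hk k0.
have [m m0 hm] := invertible_below iT.
have xp : 0 < nrm x0 by rewrite lt0r x00 nrm_ge0.
have key x : k ^+ 2 * nrm (T x) ^+ 2 <= (k ^+ 4 - m ^+ 2) * nrm x ^+ 2.
  have h1 : nrm (T (T x)) ^+ 2 <= k ^+ 2 * nrm (T x) ^+ 2.
    by rewrite -exprMn ler_pXn2r ?nnegrE ?mulr_ge0 ?nrm_ge0.
  have : (m * nrm x) ^+ 2 <= nrm (T (T x) - (k ^+ 2)%:C *: x) ^+ 2.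
    by rewrite ler_pXn2r ?nnegrE ?mulr_ge0 ?nrm_ge0 // ltW.
  rewrite -ipxx !ipE (ipC x) (sT (T x) x) !ipxx.
  have -> : k ^+ 4 = k ^+ 2 * k ^+ 2 by rewrite -exprD.
  lra.
have hc : 0 <= k ^+ 4 - m ^+ 2.
  rewrite -(pmulr_lge0 _ (exprn_gt0 2 xp)) (le_trans _ (key x0)) //.
  by rewrite mulr_ge0 ?sqr_ge0.
have kp : 0 < k.
  rewrite lt0r k0 andbT; apply/eqP => e; move: hc.
  by rewrite e expr0n /= sub0r oppr_ge0 leNgt exprn_gt0.
set d := Num.sqrt (k ^+ 4 - m ^+ 2) / k.
have : opnorm T <= d.
  apply/opnorm_leP => //; first by rewrite divr_ge0 ?sqrtr_ge0.
  move=> x; rewrite /d mulrAC ler_pdivlMr // mulrC.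
  rewrite -(@ler_pXn2r _ 2) ?nnegrE ?mulr_ge0 ?nrm_ge0 ?sqrtr_ge0 //.
  by rewrite !exprMn sqr_sqrtr // key.
rewrite -/k /d ler_pdivlMr // -(@ler_pXn2r _ 2) ?nnegrE ?mulr_ge0 ?sqrtr_ge0 //.
rewrite sqr_sqrtr // -expr2 -exprM.
by have := exprn_gt0 2 m0; lra.
Qed.

Lemma poly_opB (p q : {poly R}) T x : poly_op (p - q) T x = poly_op p T x - poly_op q T x.
Proof.
by rewrite !poly_op_cpoly rmorphB /= cpolyD -scaleN1r cpolyZ scaleN1r.
Qed.

Lemma poly_opM (p q : {poly R}) T x : linear T ->
  poly_op (p * q) T x = poly_op p T (poly_op q T x).
Proof. by move=> hT; rewrite !poly_op_cpoly rmorphM /= cpolyM. Qed.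

Lemma poly_opX T x : linear T -> poly_op 'X T x = T x.
Proof. by move=> hT; rewrite poly_op_cpoly map_polyX cpolyX. Qed.

Lemma poly_opC (k : R) T x : poly_op k%:P T x = k%:C *: x.
Proof. by rewrite poly_op_cpoly map_polyC cpolyC. Qed.

Lemma poly_op1 T x : poly_op 1 T x = x.
Proof. by rewrite poly_op_cpoly rmorph1 cpolyC scale1r. Qed.

Lemma poly_opMXD (q : {poly R}) (k : R) T x : linear T ->
  poly_op (q * 'X + k%:P) T x = T (poly_op q T x) + k%:C *: x.
Proof.
move=> hT.
by rewrite !poly_op_cpoly rmorphD rmorphM /= map_polyX map_polyC cpolyD cpolyMX // cpolyC.
Qed.

Lemma poly_op_comp_Xn (q : {poly R}) n T x : linear T ->
  poly_op (q \Po 'X^n) T x = poly_op q (iter n T) x.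
Proof.
move=> hT; have hn := lin_iter n hT.
have e k y : poly_op 'X^k T y = iter k T y.
  elim: k => [|k IH]; first by rewrite expr0 poly_op1.
  by rewrite exprS poly_opM // poly_opX // IH.
elim/poly_ind: q x => [|q k IH] x; first by rewrite comp_poly0 !poly_op_cpoly rmorph0 !cpoly0.
rewrite comp_poly_MXaddC poly_opMXD // -IH -e -poly_opM // mulrC !poly_op_cpoly.
by rewrite rmorphD /= cpolyD map_polyC cpolyC.
Qed.

Lemma poly_op_comm (q : {poly R}) T V : linear T -> linear V ->
  (forall x, T (V x) = V (T x)) -> forall x, poly_op q T (V x) = V (poly_op q T x).
Proof.
move=> hT hV hc x; rewrite !poly_op_cpoly.
elim/poly_ind: q x => [|q k IH] x; first by rewrite rmorph0 !cpoly0 lin0.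
rewrite rmorphD rmorphM /= map_polyX map_polyC !cpolyD !cpolyMX // !cpolyC IH.
by rewrite (linD hV) (linZ hV) hc.
Qed.

Lemma poly_op_form_sym (q : {poly R}) T : linear T -> form_sym T -> form_sym (poly_op q T).
Proof.
move=> hT sT x y; elim/poly_ind: q x y => [|q k IH] x y.
  by rewrite poly_op_cpoly rmorph0 !cpoly0 ip0l ip0r.
have e z : poly_op (q * 'X + k%:P) T z = T (poly_op q T z) + k%:C *: z.
  by rewrite !poly_op_cpoly rmorphD rmorphM /= map_polyX map_polyC cpolyD cpolyMX // cpolyC.
rewrite !e !ipE sT IH; congr (ip _ _ + _).
exact: poly_op_comm.
Qed.

(** By [opnorm_sqr_not_regular] the polynomial X^2 - ||T||^2 must have a root in
the spectrum. *)
Lemma spectrum_nonempty T x0 : bounded_op T -> form_sym T -> nrm x0 != 0 ->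
  exists l : R, spectrum T l%:C.
Proof.
move=> bT sT x00; have [M hM] := bounded_form_between bT sT.
apply: contrapT => hn; apply: (opnorm_sqr_not_regular bT sT x00).
have -> : (fun x => T (T x) - (opnorm T ^+ 2)%:C *: x) =
    cpoly ('X * 'X + (- (opnorm T ^+ 2)%:C)%:P) T.
  apply/funext => x; rewrite cpolyD cpolyC scaleNr; congr (_ - _).
  by have [hT _] := bT; rewrite cpolyMX // cpolyX.
apply: invertible_cpoly => //.
  rewrite -size_poly_gt0 size_polyDl -?expr2 ?size_polyXn // size_polyC.
  by case: (_ != _).
move=> l _ sl; apply: hn; exists (complex.Re l).
by rewrite -(spectrum_real hM sl).
Qed.

(** If k = ||q(T)|| exceeded the bound e, then q^2 - k^2 would have no zero on the
spectrum, so q(T)^2 - k^2 would be invertible, against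
[opnorm_sqr_not_regular].  When q^2 - k^2 is the zero polynomial the contradiction
comes from any point of the spectrum; on the zero space there is nothing to
prove. *)
Lemma poly_op_spectral_bound (q : {poly R}) T e : bounded_op T -> form_sym T -> 0 <= e ->
  (forall x : R, spectrum T x%:C -> `|q.[x]| <= e) -> opbound (poly_op q T) e.
Proof.
move=> bT sT e0 hq; have [M hM] := bounded_form_between bT sT; have [hT _] := bT.
have [[x0 x00]|htriv] := pselect (exists x0 : H, nrm x0 != 0); last first.
  have h0 x : nrm x = 0 by apply/eqP; apply: contrapT => /negP hx; apply: htriv; exists x.
  by move=> x; rewrite !h0 mulr0.
have bQ : bounded_op (poly_op q T) by rewrite poly_op_cpoly; exact: bounded_cpoly.
have sQ := poly_op_form_sym q hT sT.
apply/opnorm_leP => //; rewrite leNgt; apply/negP => lt.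
set k := opnorm _ in lt.
have hk l : spectrum T l%:C -> q.[l] ^+ 2 = k ^+ 2 -> False.
  move=> sl; have := hq _ sl; rewrite -real_normK ?num_real // => h1 h2.
  have : k ^+ 2 <= e ^+ 2 by rewrite -h2 ler_pXn2r ?nnegrE.
  by apply/negP; rewrite -ltNge ltr_pXn2r ?nnegrE // ltW // (le_lt_trans e0).
set p := map_poly (real_complex R) (q * q - (k ^+ 2)%:P).
have pE l : p.[l%:C] = (q.[l] ^+ 2 - k ^+ 2)%:C.
  by rewrite horner_map !hornerE /= expr2.
have [p0|p0] := eqVneq p 0.
  have [l sl] := spectrum_nonempty bT sT x00.
  apply: (hk l sl); apply/eqP; rewrite -subr_eq0; apply/eqP.
  by apply: complexI; rewrite -pE p0 horner0.
apply: (opnorm_sqr_not_regular bQ sQ x00); rewrite -/k.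
have -> : (fun x => poly_op q T (poly_op q T x) - (k ^+ 2)%:C *: x) = cpoly p T.
  by apply/funext => x; rewrite /p -poly_op_cpoly poly_opB poly_opM // poly_opC.
apply: invertible_cpoly => // l lr sl.
move: lr sl; have := fun sl => spectrum_real hM sl => hr.
move=> lr sl; have el := hr _ sl; move: lr sl; rewrite el => lr sl.
apply: (hk _ sl); apply/eqP; rewrite -subr_eq0; apply/eqP/complexI.
by rewrite -pE; apply/eqP.
Qed.

(** * Continuous functional calculus *)

Lemma nrm_arbitrarily_small x c : (forall e, 0 < e -> nrm x <= e * c) -> x = 0.
Proof.
move=> h; apply/nrm_eq0/le_anti; rewrite nrm_ge0 andbT.
apply/ler_addgt0Pl => e e0; rewrite addr0.
have c0 : 0 < `|c| + 1 by rewrite ltr_wpDl.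
have := h _ (divr_gt0 e0 c0) => /le_trans; apply.
rewrite mulrAC ler_pdivrMr // ler_pM2l // (le_trans (ler_norm c)) //.
by rewrite lerDl.
Qed.

Lemma bounded_poly_op (q : {poly R}) T : bounded_op T -> bounded_op (poly_op q T).
Proof. by move=> bT; rewrite poly_op_cpoly; exact: bounded_cpoly. Qed.

Implicit Types (f g : R -> R) (X Y Z : H -> H).

Lemma is_cfcP T f X : bounded_op T -> is_cfc T f X <-> bounded_op X /\
  forall e, 0 < e -> exists q : {poly R},
    (forall x : R, spectrum T x%:C -> `|q.[x] - f x| <= e) /\
    opbound (fun v => X v - poly_op q T v) e.
Proof.
move=> bT; split=> -[bX h]; split=> // e e0; have [q [h1 h2]] := h _ e0; exists q; split=> //.
  by apply/opnorm_leP => //; [exact: ltW|exact: bounded_sub bX (bounded_poly_op q bT)].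
by apply/opnorm_leP => //; [exact: ltW|exact: bounded_sub bX (bounded_poly_op q bT)].
Qed.

(** X and Y are close to polynomials in T whose values differ by little more than e
on the spectrum.  The case e = 0 is uniqueness. *)
Lemma cfc_diff T f g X Y e : bounded_op T -> form_sym T -> 0 <= e -> is_cfc T f X -> is_cfc T g Y ->
  (forall x : R, spectrum T x%:C -> `|f x - g x| <= e) -> opbound (fun v => X v - Y v) e.
Proof.
move=> bT sT e0 /is_cfcP-/(_ bT)[bX hX] /is_cfcP-/(_ bT)[bY hY] hfg x.
apply/ler_addgt0Pl => d d0.
have n0 : 0 < 4 * (nrm x + 1) by rewrite mulr_gt0 // ltr_wpDl ?nrm_ge0.
have d'0 := divr_gt0 d0 n0; set d' := d / _ in d'0.
have [p [hp1 /(_ x) hp2]] := hX _ d'0; have [q [hq1 /(_ x) hq2]] := hY _ d'0.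
have hb : opbound (poly_op (p - q) T) (e + d' + d').
  apply: poly_op_spectral_bound => //; first by rewrite !addr_ge0 // ltW.
  move=> l sl; rewrite hornerD hornerN.
  have := hp1 _ sl; have := hq1 _ sl; have := hfg _ sl.
  rewrite !ler_norml; lra.
have -> : X x - Y x = (X x - poly_op p T x) - (Y x - poly_op q T x) + poly_op (p - q) T x.
  by apply: ip_sep => z; rewrite poly_opB !ipE; ring.
have := hb x; have := nrmD ((X x - poly_op p T x) - (Y x - poly_op q T x)) (poly_op (p - q) T x).
have := nrmD (X x - poly_op p T x) (- (Y x - poly_op q T x)); rewrite nrmN.
have : d' * (4 * (nrm x + 1)) = d by rewrite divfK // gt_eqF.
lra.
Qed.

Lemma is_cfc_uniq T f X Y : bounded_op T -> form_sym T -> is_cfc T f X -> is_cfc T f Y -> X = Y.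
Proof.
move=> bT sT hX hY; apply/funext => x; apply/eqP; rewrite -subr_eq0; apply/eqP/nrm_eq0/le_anti.
rewrite nrm_ge0 andbT -(mul0r (nrm x)).
by apply: (cfc_diff bT sT _ hX hY) => // l _; rewrite subrr normr0.
Qed.

Lemma cfcE T f X : bounded_op T -> form_sym T -> is_cfc T f X -> cfc T f = X.
Proof. by move=> bT sT hX; apply: is_cfc_uniq (getI hX) hX. Qed.

Lemma is_cfc_ext T f g X : (forall x : R, spectrum T x%:C -> f x = g x) ->
  is_cfc T f X -> is_cfc T g X.
Proof.
move=> fg [bX h]; split=> // e /h [q [h1 h2]]; exists q; split=> // x sx.
by rewrite -fg // h1.
Qed.

Lemma is_cfc_poly T (q : {poly R}) : bounded_op T -> is_cfc T (fun x : R => q.[x]) (poly_op q T).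
Proof.
move=> bT; apply/is_cfcP => //; split; first exact: bounded_poly_op.
move=> e e0; exists q; split=> x; first by rewrite subrr normr0 ltW.
by rewrite subrr nrm0 mulr_ge0 ?nrm_ge0 // ltW.
Qed.

(** The operators q_n(T), for polynomials q_n within 1/(n+1) of f on [m, M], form a
Cauchy sequence by [poly_op_spectral_bound]. *)
Lemma is_cfc_exists T f m M : form_between T m M ->
  (forall e, 0 < e -> exists q : {poly R}, forall x : R, m <= x <= M -> `|q.[x] - f x| <= e) ->
  exists X, is_cfc T f X.
Proof.
move=> hT hf; have bT := form_between_bounded hT; have [lT sT _ _] := hT.
pose d n : R := n.+1%:R^-1.
have d0 n : 0 < d n by rewrite invr_gt0.
have /choice[q hq] : forall n, exists q : {poly R}, forall x : R, m <= x <= M -> `|q.[x] - f x| <= d n.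
  by move=> n; exact: hf.
have hnk n k : opbound (poly_op (q n - q k) T) (d n + d k).
  apply: poly_op_spectral_bound => //; first by rewrite addr_ge0 // ltW.
  move=> x /(spectrum_itv hT) hx; rewrite hornerD hornerN.
  by have := hq n _ hx; have := hq k _ hx; rewrite !ler_norml; lra.
have dsmall e : 0 < e -> exists N, forall n, (N <= n)%N -> d n <= e.
  move=> e0; exists (Num.truncn e^-1) => n hn; rewrite /d invf_ple ?posrE //.
  by rewrite (le_trans (ltW (truncnS_gt _))) // ler_nat ltnS.
have /choice[X hX] : forall x, exists y, forall n, nrm (y - poly_op (q n) T x) <= d n * nrm x.
  move=> x; have x1 : 0 < nrm x + 1 by rewrite ltr_wpDl ?nrm_ge0.
  have [|y hy] := @nrm_cauchy_cvg (fun n => poly_op (q n) T x).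
    move=> e e0; have [N hN] := dsmall _ (divr_gt0 e0 (mulr_gt0 (ltr0n R 2) x1)).
    exists N => n k /hN hn /hN hk; rewrite -poly_opB (le_trans (hnk _ _ _)) //.
    have : (d n + d k) * (nrm x + 1) <= e.
      rewrite -ler_pdivlMr // (le_trans (lerD hn hk)) //.
      have -> : e / (2 * (nrm x + 1)) + e / (2 * (nrm x + 1)) = e / (nrm x + 1).
        by field; exact: lt0r_neq0.
      by [].
    have := d0 n; have := d0 k; lra.
  exists y => n; apply/ler_addgt0Pl => e e0.
  have [N hN] := hy _ (divr_gt0 e0 (ltr0n R 2)).
  have [N' hN'] := dsmall _ (divr_gt0 e0 (mulr_gt0 (ltr0n R 2) x1)).
  pose k := maxn N N'.
  have := hN k (leq_maxl _ _); have := hN' k (leq_maxr _ _).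
  rewrite ler_pdivlMr ?mulr_gt0 // => h1 h2.
  have -> : y - poly_op (q n) T x = - (poly_op (q k) T x - y) + poly_op (q k - q n) T x.
    by apply: ip_sep => z; rewrite poly_opB !ipE; ring.
  rewrite (le_trans (nrmD _ _)) // nrmN.
  have := hnk k n x; have := d0 k; have := nrm_ge0 x; nra.
have lX : linear X.
  move=> a x y; apply/eqP; rewrite -subr_eq0; apply/eqP.
  apply: (@nrm_arbitrarily_small _ (nrm (a *: x + y) + nrm (a *: x) + nrm y)) => e e0.
  have [N /(_ N (leqnn N)) hN] := dsmall _ e0.
  have [lq _] := bounded_poly_op (q N) bT.
  have -> : X (a *: x + y) - (a *: X x + X y) = (X (a *: x + y) - poly_op (q N) T (a *: x + y))
     - (a *: (X x - poly_op (q N) T x)) - (X y - poly_op (q N) T y).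
    by rewrite lq; apply: dot_sep => z; rewrite !dotE; ring.
  have h1 := hX (a *: x + y) N; have h3 := hX y N.
  have h2 : nrm (a *: (X x - poly_op (q N) T x)) <= d N * nrm (a *: x).
    rewrite -lecR rmorphM /= !nrmE !normrZ mulrCA ler_wpM2l // -!nrmE -rmorphM lecR.
    exact: hX.
  rewrite (le_trans (nrmD _ _)) // nrmN.
  have := nrmD (X (a *: x + y) - poly_op (q N) T (a *: x + y)) (- (a *: (X x - poly_op (q N) T x))).
  rewrite nrmN.
  have := nrm_ge0 (a *: x + y); have := nrm_ge0 (a *: x); have := nrm_ge0 y; nra.
exists X; apply/is_cfcP => //; split.
  have [K K0 hK] := bounded_opbound (bounded_poly_op (q 0%N) bT).
  apply: (@opbound_bounded _ (1 + K)) => // x; have := hX x 0%N; have := hK x.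
  have := nrmD (X x - poly_op (q 0%N) T x) (poly_op (q 0%N) T x).
  by rewrite subrK /d invr1; lra.
move=> e e0; have [N /(_ N (leqnn N)) hN] := dsmall _ e0.
exists (q N); split=> x; first by move/(spectrum_itv hT)/(hq N) => /le_trans; apply.
by rewrite (le_trans (hX x N)) // ler_wpM2r ?nrm_ge0.
Qed.

Lemma is_cfc_form_sym T f X : bounded_op T -> form_sym T -> is_cfc T f X -> form_sym X.
Proof.
move=> bT sT /is_cfcP-/(_ bT)[bX hX] x y; have [lT _] := bT.
apply/eqP; rewrite -subr_eq0 -normr_le0; apply/ler_addgt0Pl => e e0; rewrite addr0.
have x1 : 0 < nrm x + 1 by rewrite ltr_wpDl ?nrm_ge0.
have y1 : 0 < nrm y + 1 by rewrite ltr_wpDl ?nrm_ge0.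
have [|q [_ hq]] := hX (e / (2 * (nrm x + 1) * (nrm y + 1))); first by rewrite divr_gt0 ?mulr_gt0.
set d := e / _ in hq.
have de : d * (2 * (nrm x + 1) * (nrm y + 1)) = e.
  by rewrite divfK // ?gt_eqF ?mulr_gt0.
have d0 : 0 < d by rewrite divr_gt0 ?mulr_gt0.
have e1 : ip (X x) y - ip x (X y) =
   ip (X x - poly_op q T x) y - ip (X y - poly_op q T y) x.
  by rewrite !ipE (poly_op_form_sym q lT sT) (ipC (X y)) (ipC (poly_op q T y)); ring.
have := hq x; have := hq y; have := ip_le (X x - poly_op q T x) y.
have := ip_ge (X x - poly_op q T x) y; have := ip_le (X y - poly_op q T y) x.
have := ip_ge (X y - poly_op q T y) x; have := nrm_ge0 x; have := nrm_ge0 y.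
rewrite e1 -de ler_norml; set u := ip _ _; set v := ip _ _.
set s := nrm (_ - _); set t := nrm (_ - _) => *.
have : t * nrm y <= d * nrm x * nrm y by rewrite ler_wpM2r.
have : s * nrm x <= d * nrm y * nrm x by rewrite ler_wpM2r.
have : 0 <= d * nrm x by rewrite mulr_ge0 // ltW.
have : 0 <= d * nrm y by rewrite mulr_ge0 // ltW.
lra.
Qed.

(** X Y - p(T) q(T) = (X - p(T)) Y + p(T) (Y - q(T)), where p(T) is bounded
through the values of p on the spectrum. *)
Lemma is_cfc_mul T f g X Y B : bounded_op T -> form_sym T -> 0 <= B ->
  (forall x : R, spectrum T x%:C -> `|f x| <= B) ->
  (forall x : R, spectrum T x%:C -> `|g x| <= B) ->
  is_cfc T f X -> is_cfc T g Y -> is_cfc T (fun x : R => f x * g x) (X \o Y).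
Proof.
move=> bT sT B0 hf hg /is_cfcP-/(_ bT)[bX hX] /is_cfcP-/(_ bT)[bY hY].
apply/is_cfcP => //; split; first exact: bounded_comp.
move=> e e0; have [K K0 hK] := bounded_opbound bY; have [lT _] := bT.
have C0 : 0 < 2 * B + 2 + K by lra.
pose d := Num.min 1 (e / (2 * B + 2 + K)).
have d0 : 0 < d by rewrite lt_min ltr01 divr_gt0.
have d1 : d <= 1 by rewrite ge_min lexx.
have de : d * (2 * B + 2 + K) <= e by rewrite -ler_pdivlMr // ge_min lexx orbT.
have [p [hp1 hp2]] := hX _ d0; have [q [hq1 hq2]] := hY _ d0.
have hpB (x : R) : spectrum T x%:C -> `|p.[x]| <= B + 1.
  by move=> sx; have := hp1 _ sx; have := hf _ sx; rewrite !ler_norml; lra.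
exists (p * q); split=> x.
  move=> sx; rewrite hornerM.
  have -> : p.[x] * q.[x] - f x * g x = p.[x] * (q.[x] - g x) + g x * (p.[x] - f x) by ring.
  rewrite (le_trans (ler_normD _ _)) // !normrM.
  have := hpB _ sx; have := hg _ sx; have := hp1 _ sx; have := hq1 _ sx.
  have := normr_ge0 p.[x]; have := normr_ge0 (g x).
  have := normr_ge0 (p.[x] - f x); have := normr_ge0 (q.[x] - g x).
  set u := `|p.[x]|; set v := `|g x|; set s := `|_ - _|; set t := `|_ - _| => *.
  have : u * s <= (B + 1) * d by rewrite ler_pM.
  have : v * t <= B * d by rewrite ler_pM.
  nra.
have -> : (X \o Y) x - poly_op (p * q) T x =
  (X (Y x) - poly_op p T (Y x)) + poly_op p T (Y x - poly_op q T x).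
  have [lp _] := bounded_poly_op p bT.
  by rewrite poly_opM // (linB lp); apply: ip_sep => z; rewrite !ipE; ring.
rewrite (le_trans (nrmD _ _)) //.
have hb : opbound (poly_op p T) (B + 1) by apply: poly_op_spectral_bound => //; rewrite addr_ge0.
have := hp2 (Y x); have := hb (Y x - poly_op q T x); have := hq2 x; have := hK x.
have := nrm_ge0 x; set nx := nrm x; set ny := nrm (Y x); set s := nrm (Y x - _) => *.
have : (B + 1) * s <= (B + 1) * (d * nx) by rewrite ler_wpM2l // addr_ge0.
have : d * ny <= d * (K * nx) by rewrite ler_wpM2l // ltW.
have : d * (2 * B + 2 + K) * nx <= e * nx by rewrite ler_wpM2r.
have : 0 <= d * (B + 1) * nx by rewrite !mulr_ge0 ?addr_ge0 ?(ltW d0).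
lra.
Qed.

(** * Powers of positive definite operators *)

Local Notation pd := (positive_definite dot).

(** The lower bound comes from the inverse: k |x| <= |T x| and
|T x|^2 <= K <T x, x>. *)
Lemma pd_form_between T : pd T -> exists m M, 0 < m /\ form_between T m M.
Proof.
case=> bT pT iT; have [lT _] := bT.
have /(positive_opP lT)[sT hp] := pT.
have [M hM] := bounded_form_between bT sT; have [_ _ _ h2] := hM.
have [k k0 hk] := invertible_below iT.
pose K := Num.max 1 M; have K0 : 0 < K by rewrite lt_max ltr01.
have hK : form_between T 0 K.
  split=> // x; first by rewrite mul0r.
  by rewrite (le_trans (h2 x)) // ler_wpM2r ?sqr_ge0 // le_max lexx orbT.
exists (k ^+ 2 / K), M; split; first by rewrite divr_gt0 ?exprn_gt0.
split=> // x; rewrite mulrAC ler_pdivrMr // mulrC [leRHS]mulrC.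
rewrite (le_trans _ (form_between_sqr x K0 hK)) // mulrC -exprMn.
by rewrite ler_pXn2r ?nnegrE ?mulr_ge0 ?nrm_ge0 // ltW.
Qed.

Lemma pd_bounded T : pd T -> bounded_op T. Proof. by case. Qed.
Lemma pd_lin T : pd T -> linear T. Proof. by case=> [[]]. Qed.
Lemma pd_form_sym T : pd T -> form_sym T.
Proof. by case=> [[lT _] /(positive_opP lT)[]]. Qed.
Lemma pd_ge0 T x : pd T -> 0 <= ip (T x) x.
Proof. by case=> [[lT _] /(positive_opP lT)[]]. Qed.

Lemma pd_spectrum T : pd T -> exists m M, [/\ 0 < m, m < M &
  forall x : R, spectrum T x%:C -> m <= x <= M].
Proof.
move=> /pd_form_between[m [M [m0 h]]]; exists m, (Num.max M (m + 1)); split=> //.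
  by rewrite lt_max ltrDl ltr01 orbT.
by move=> x /(spectrum_itv h)/andP[-> h1]; rewrite le_max h1.
Qed.

Lemma op_powP T t : pd T -> is_cfc T (fun x : R => x `^ t) (op_pow T t).
Proof.
move=> hT; have [m [M [m0 h]]] := pd_form_between hT.
pose M' := Num.max M (m + 1).
have mM : m < M' by rewrite lt_max ltrDl ltr01 orbT.
have h' : form_between T m M' by apply: form_between_weaken h => //; rewrite le_max lexx.
have [L L0 hL] := powR_lip M' t m0.
have [|X hX] := @is_cfc_exists T (fun x : R => x `^ t) m M' h'.
  move=> e e0; exact: lipschitz_approx hL.
exact: getI hX.
Qed.

Lemma op_pow_bounded T t : pd T -> bounded_op (op_pow T t).
Proof. by move/op_powP => /(_ t)[]. Qed.
Lemma op_pow_lin T t : pd T -> linear (op_pow T t).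
Proof. by move=> /(op_pow_bounded t)[]. Qed.
Lemma op_pow_form_sym T t : pd T -> form_sym (op_pow T t).
Proof. by move=> hT; apply: is_cfc_form_sym (pd_bounded hT) (pd_form_sym hT) (op_powP t hT). Qed.

Lemma op_pow_uniq T t X : pd T -> is_cfc T (fun x : R => x `^ t) X -> op_pow T t = X.
Proof. move=> hT; exact: cfcE (pd_bounded hT) (pd_form_sym hT). Qed.

Lemma op_pow0 T x : pd T -> op_pow T 0 x = x.
Proof.
move=> hT; suff -> : op_pow T 0 = poly_op 1 T by rewrite poly_op1.
apply: op_pow_uniq => //; apply: is_cfc_ext (is_cfc_poly 1 (pd_bounded hT)) => y _.
by rewrite hornerC powRr0.
Qed.

Lemma op_pow1 T x : pd T -> op_pow T 1 x = T x.
Proof.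
move=> hT; suff -> : op_pow T 1 = poly_op 'X T by rewrite poly_opX //; exact: pd_lin.
have [m [M [m0 _ hs]]] := pd_spectrum hT.
apply: op_pow_uniq => //; apply: is_cfc_ext (is_cfc_poly 'X (pd_bounded hT)) => y /hs /andP[my _].
by rewrite hornerX powRr1 // ltW // (lt_le_trans m0).
Qed.

(** The functional calculus is multiplicative, and powers are bounded on the
spectrum, which lies in some [m, M] with m > 0. *)
Lemma op_powD T s t x : pd T -> op_pow T s (op_pow T t x) = op_pow T (s + t) x.
Proof.
move=> hT; have [m [M [m0 mM hs]]] := pd_spectrum hT.
suff -> : op_pow T (s + t) = op_pow T s \o op_pow T t by [].
apply: op_pow_uniq => //.
have [B B0 [hB1 hB2]] : exists2 B : R, 0 <= B & (forall x : R, spectrum T x%:C -> `|x `^ s| <= B)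
   /\ (forall x : R, spectrum T x%:C -> `|x `^ t| <= B).
  pose K := `|ln m| + `|ln M|.
  have K0 : 0 <= K by rewrite addr_ge0.
  have hb r (y : R) : spectrum T y%:C -> `|y `^ r| <= expR (`|r| * K).
    move=> /hs hy; have /andP[my _] := hy.
    rewrite ger0_norm ?powR_ge0 // powR_expR ?(lt_le_trans m0) // ler_expR.
    by rewrite (le_trans (ler_norm _)) // normrM ler_wpM2l // (ln_bound m0 hy).
  exists (expR (`|s| * K) + expR (`|t| * K)); first by rewrite addr_ge0 ?expR_ge0.
  by split=> y /hb h; rewrite (le_trans (h _)) // ?lerDl ?lerDr expR_ge0.
apply: is_cfc_ext (is_cfc_mul (pd_bounded hT) (pd_form_sym hT) B0 hB1 hB2 (op_powP s hT) (op_powP t hT)).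
move=> y /hs/andP[my _].
have y0 : y != 0 by rewrite gt_eqF // (lt_le_trans m0).
by rewrite powRD // y0 implybT.
Qed.

Lemma op_powK T t x : pd T -> op_pow T (- t) (op_pow T t x) = x.
Proof. by move=> hT; rewrite op_powD // addNr op_pow0. Qed.
Lemma op_powVK T t x : pd T -> op_pow T t (op_pow T (- t) x) = x.
Proof. by move=> hT; rewrite op_powD // subrr op_pow0. Qed.

(** T^t is the square of the self-adjoint operator T^(t/2), with inverse T^(-t). *)
Lemma op_pow_pd T t : pd T -> pd (op_pow T t).
Proof.
move=> hT; split.
- exact: op_pow_bounded.
- apply/(positive_opP (op_pow_lin t hT)); split; first exact: op_pow_form_sym.
  move=> x; rewrite (_ : t = t / 2 + t / 2); last by rewrite -splitr.
  by rewrite -op_powD // op_pow_form_sym // ipxx sqr_ge0.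
- exists (op_pow T (- t)); split; first exact: op_pow_bounded.
    by apply/funext => x /=; rewrite op_powK.
  by apply/funext => x /=; rewrite op_powVK.
Qed.

Lemma op_pow_half T t x : pd T ->
  ip (op_pow T (t / 2) x) (op_pow T (t / 2) x) = ip (op_pow T t x) x.
Proof. by move=> hT; rewrite -op_pow_form_sym // op_powD // -splitr. Qed.

Lemma iter_op_pow T t n x : pd T -> iter n (op_pow T t) x = op_pow T (n%:R * t) x.
Proof.
move=> hT; elim: n => [|n IH]; first by rewrite mul0r op_pow0.
by rewrite iterS IH op_powD // -natr1 mulrDl mul1r addrC.
Qed.

Lemma iter_op_pow_nat T n x : pd T -> iter n T x = op_pow T n%:R x.
Proof.
move=> hT; rewrite -[n%:R]mulr1 -iter_op_pow //; congr (iter n _ x).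
by apply/funext => y; rewrite op_pow1.
Qed.

Lemma iter_pd T n : pd T -> pd (iter n T).
Proof.
move=> hT; rewrite (_ : iter n T = op_pow T n%:R); first exact: op_pow_pd.
by apply/funext => x; rewrite iter_op_pow_nat.
Qed.

(** Uniqueness of positive definite roots.  If q is close to x^(1/(n+1)) on a large
interval then q(x^(n+1)) is close to x on the spectrum of Y, so q(Y^(n+1)) is
close to Y; hence Y itself is a value of the functional calculus of Y^(n+1). *)
Lemma op_pow_root Y n : pd Y -> op_pow (iter n.+1 Y) (n.+1%:R^-1) = Y.
Proof.
move=> hY; have hZ := iter_pd n.+1 hY; set Z := iter n.+1 Y in hZ *.
apply: op_pow_uniq => //; apply/is_cfcP; first exact: pd_bounded.
split; first exact: pd_bounded.
move=> e e0; have [m [M [m0 mM hs]]] := pd_spectrum hY.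
have [m' [M' [m'0 mM' hs']]] := pd_spectrum hZ.
(* The interval [a, b] contains the spectrum of Y^(n+1) and the (n+1)-st powers
   of the spectrum of Y. *)
pose a := Num.min m' (m ^+ n.+1); pose b := Num.max M' (M ^+ n.+1).
have a0 : 0 < a by rewrite lt_min m'0 exprn_gt0.
have ab : a < b by rewrite lt_max gt_min mM'.
have [L L0 hL] := powR_lip b (n.+1%:R^-1) a0.
have [q hq] := lipschitz_approx ab L0 e0 hL.
exists q; split=> [x /hs'/andP[h1 h2]|].
  by apply: hq; rewrite ge_min h1 le_max h2 ?orbT.
move=> x.
have -> : Y x - poly_op q Z x = poly_op ('X - (q \Po 'X^(n.+1))) Y x.
  by rewrite poly_opB poly_opX ?poly_op_comp_Xn //; exact: pd_lin.
apply: (poly_op_spectral_bound (pd_bounded hY) (pd_form_sym hY) (ltW e0)) => y /hs/andP[h1 h2].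
have y0 : 0 < y by rewrite (lt_le_trans m0).
rewrite hornerD hornerN hornerX horner_comp hornerXn distrC.
have ye : (y ^+ n.+1) `^ (n.+1%:R^-1) = y.
  by rewrite -powR_mulrn ?(ltW y0) // -powRrM mulfV ?pnatr_eq0 // powRr1 // ltW.
rewrite -[X in _ - X]ye.
apply: hq; rewrite ge_min le_max.
by rewrite !ler_pXn2r ?nnegrE ?h1 ?h2 ?orbT // ltW // (lt_trans m0 mM).
Qed.

Lemma op_rootK Z n x : pd Z -> iter n.+1 (op_pow Z n.+1%:R^-1) x = Z x.
Proof. by move=> hZ; rewrite iter_op_pow // mulfV ?pnatr_eq0 // op_pow1. Qed.

(** * The order of operators *)

Definition form_ge T U := forall x, ip (U x) x <= ip (T x) x.

Lemma op_geP T U : linear T -> linear U -> form_sym T -> form_sym U ->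
  op_ge dot T U <-> form_ge T U.
Proof.
move=> lT lU sT sU; have lTU := lin_sub lT lU; split.
  case=> _ _ /(positive_opP lTU)[_ h] x; have := h x.
  by rewrite !ipE subr_ge0.
move=> h; split; [exact: form_sym_self_adjoint|exact: form_sym_self_adjoint|].
apply/(positive_opP lTU); split=> x; first by move=> y; rewrite !ipE sT sU.
by rewrite !ipE subr_ge0.
Qed.

Lemma op_ge_pd T U : pd T -> pd U -> op_ge dot T U <-> form_ge T U.
Proof. by move=> hT hU; apply: op_geP; by [exact: pd_lin | exact: pd_form_sym]. Qed.

(** T^s tends to T^t in norm as s tends to t; read on the quadratic form, in which
[lowner_heinz] passes to the limit. *)
Lemma op_pow_cont T t e : pd T -> 0 < e -> exists2 d, 0 < d &
  forall s x, `|s - t| <= d -> `|ip (op_pow T s x) x - ip (op_pow T t x) x| <= e * nrm x ^+ 2.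
Proof.
move=> hT e0; have [m [M [m0 mM hs]]] := pd_spectrum hT.
have [d d0 hd] := powR_cont M t m0 e0.
exists d => // s x hst.
have hb := cfc_diff (pd_bounded hT) (pd_form_sym hT) (ltW e0) (op_powP s hT) (op_powP t hT).
have {}hb := hb (fun (y : R) sy => hd s y hst (hs y sy)) x.
rewrite -ipNl -ipDl ler_norml.
have := ip_le (op_pow T s x - op_pow T t x) x; have := ip_ge (op_pow T s x - op_pow T t x) x.
have : nrm (op_pow T s x - op_pow T t x) * nrm x <= e * nrm x * nrm x.
  by rewrite ler_wpM2r ?nrm_ge0.
rewrite expr2; lra.
Qed.

Lemma sandwich_pd T S : pd T -> pd S -> pd (S \o T \o S).
Proof.
move=> hT hS; have lS := pd_lin hS; split.
- apply: bounded_comp; first apply: bounded_comp; exact: pd_bounded.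
- apply/(positive_opP (lin_comp lS (lin_comp (pd_lin hT) lS))); split=> x.
    by move=> y; rewrite /= (pd_form_sym hS) (pd_form_sym hT) (pd_form_sym hS).
  by rewrite /= (pd_form_sym hS) pd_ge0.
- by have [_ _ iT] := hT; have [_ _ iS] := hS; exact: invertible_comp (invertible_comp iS iT) iS.
Qed.

Lemma adjoint_opbound V V' c : (forall x y, ip (V x) y = ip x (V' y)) -> opbound V c -> opbound V' c.
Proof.
move=> h hV y; have [y0|y0] := eqVneq (nrm (V' y)) 0.
  rewrite y0; have := hV y; have := nrm_ge0 (V y); lra.
have yp : 0 < nrm (V' y) by rewrite lt0r y0 nrm_ge0.
rewrite -(ler_pM2r yp) -expr2 -ipxx -h (le_trans (ip_le _ _)) //.
by rewrite mulrAC ler_wpM2r ?nrm_ge0 // hV.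
Qed.

(** Neumann series for W/l. *)
Lemma shift_invertible W (l : R) : linear W -> opbound W 1 -> 1 < `|l| ->
  invertible_op (fun x => W x - l%:C *: x).
Proof.
move=> lW hW l1; have l0 : 0 < `|l| by rewrite (lt_trans ltr01).
have ln0 : l != 0 by rewrite -normr_gt0.
apply: (@bij_invertible _ (`|l| - 1)).
- by apply: lin_sub => //; exact: (lin_scale _ lin_id).
- by rewrite subr_gt0.
- move=> x; have := nrmD (l%:C *: x - W x) (W x); rewrite subrK nrmZ nrmB.
  have := hW x; lra.
- move=> y; pose V x := l^-1%:C *: W x.
  have [||||x hx] := @neumann_surj V `|l|^-1 _ _ _ _ (- (l^-1%:C *: y)).
  + exact: lin_scale.
  + by rewrite invr_ge0.
  + by rewrite invf_lt1.
  + by move=> x; rewrite nrmZ normfV ler_wpM2l ?invr_ge0 // -[leRHS]mul1r.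
  exists x; move: hx; rewrite /V => /(congr1 (fun z => - (l%:C *: z))).
  rewrite scalerBr !scalerN opprK opprB !scalerA -!rmorphM mulfV //.
  by rewrite !scale1r.
Qed.

(** Pedersen's argument.  The hypotheses make B^(a/2) A^(-a/2) and
B^(b/2) A^(-b/2) contractions, hence also W = A^(-a/2) B^c A^(-b/2).  The
self-adjoint P = A^(-c/2) B^c A^(-c/2) is similar to W, so its spectrum lies in
[-1, 1], and therefore P <= 1. *)
Lemma form_ge_midpoint A B a b : pd A -> pd B ->
  form_ge (op_pow A a) (op_pow B a) -> form_ge (op_pow A b) (op_pow B b) ->
  form_ge (op_pow A ((a + b) / 2)) (op_pow B ((a + b) / 2)).
Proof.
move=> hA hB.
have hV t : form_ge (op_pow A t) (op_pow B t) ->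
    opbound (op_pow B (t / 2) \o op_pow A (- (t / 2))) 1.
  move=> ht x /=; rewrite mul1r -(@ler_pXn2r _ 2) ?nnegrE ?nrm_ge0 // -!ipxx.
  rewrite -op_pow_form_sym // op_powD // -splitr (le_trans (ht _)) //.
  by rewrite {1}(splitr t) -op_powD // op_pow_form_sym // op_powVK.
move=> /hV ha /hV hb; set c := (a + b) / 2.
have ha' : opbound (op_pow A (- (a / 2)) \o op_pow B (a / 2)) 1.
  by apply: adjoint_opbound ha => x y /=; rewrite op_pow_form_sym // op_pow_form_sym.
pose W := op_pow A (- (a / 2)) \o op_pow B c \o op_pow A (- (b / 2)).
have hW : opbound W 1.
  move=> x; rewrite mul1r.
  have -> : W x = (op_pow A (- (a / 2)) \o op_pow B (a / 2))
      ((op_pow B (b / 2) \o op_pow A (- (b / 2))) x).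
    by rewrite /= op_powD // -mulrDl.
  by rewrite (le_trans (ha' _)) // mul1r (le_trans (hb _)) // mul1r.
have lW : linear W by apply: lin_comp; first apply: lin_comp; exact: op_pow_lin.
pose P := op_pow A (- (c / 2)) \o op_pow B c \o op_pow A (- (c / 2)).
have hP : pd P by apply: sandwich_pd; exact: op_pow_pd.
(* W and P differ by conjugation with A^g: -a/2 + g = -c/2 and -b/2 - g = -c/2. *)
pose g := (a - b) / 4.
have PW x l : P x - l *: x = op_pow A g (W (op_pow A (- g) x) - l *: op_pow A (- g) x).
  rewrite (linB (op_pow_lin _ hA)) (linZ (op_pow_lin _ hA)) op_powVK //.
  rewrite /W /P /= !op_powD //; congr (op_pow A _ (op_pow B _ (op_pow A _ _)) - _).
    by rewrite /g /c; field.
  by rewrite /g /c; field.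
have hb1 : opbound (poly_op 'X P) 1.
  apply: poly_op_spectral_bound => //; [exact: pd_bounded|exact: pd_form_sym|].
  move=> l sl; rewrite hornerX leNgt; apply/negP => hl; apply: sl.
  rewrite (_ : (fun x => _) = op_pow A g \o (fun x => W x - l%:C *: x) \o op_pow A (- g)).
    apply: invertible_comp; first apply: invertible_comp.
    - by have [] := op_pow_pd g hA.
    - exact: shift_invertible.
    - by have [] := op_pow_pd (- g) hA.
  by apply/funext => x; rewrite PW.
move=> y; pose x := op_pow A (c / 2) y.
have := hb1 x; rewrite poly_opX; last exact: pd_lin.
rewrite mul1r => h1.
have h2 : ip (P x) x <= ip x x.
  by rewrite ipxx expr2 (le_trans (ip_le _ _)) // ler_wpM2r ?nrm_ge0.
move: h2; rewrite /P /x /= op_powK // op_pow_form_sym // op_powK //.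
by rewrite op_pow_half.
Qed.

Lemma form_ge_dyadic A B n k : pd A -> pd B -> form_ge A B -> (k <= 2 ^ n)%N ->
  form_ge (op_pow A (k%:R / 2 ^+ n)) (op_pow B (k%:R / 2 ^+ n)).
Proof.
move=> hA hB AB; elim: n k => [|n IH] k hk.
  case: k hk => [|[|//]] _ x; first by rewrite mul0r !op_pow0.
  by rewrite divr1 !op_pow1.
(* k = floor (k/2) + ceil (k/2) exhibits k/2^(n+1) as a midpoint. *)
have -> : k%:R / 2 ^+ n.+1 = (k./2%:R / 2 ^+ n + (uphalf k)%:R / 2 ^+ n) / 2 :> R.
  by rewrite -mulrDl -natrD uphalf_half addnCA addnn odd_double_half exprSr invfM mulrA.
move: hk; rewrite expnS mul2n => hk.
apply: form_ge_midpoint => //; apply: IH; last by rewrite leq_uphalf_double.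
by rewrite leq_half_double leqW.
Qed.

(** The exponents for which the order is preserved contain 0 and 1, are stable
under midpoints, and form a closed set. *)
Lemma lowner_heinz A B r : pd A -> pd B -> form_ge A B -> 0 <= r <= 1 ->
  form_ge (op_pow A r) (op_pow B r).
Proof.
have arith (u v u' v' w d e : R) : 0 < d -> d * (2 * (w + 1)) = e ->
    u <= v -> - (d * w) <= u - u' <= d * w -> - (d * w) <= v - v' <= d * w ->
    u' <= e + v' by lra.
move=> hA hB AB /andP[r0 r1] x; apply/ler_addgt0Pl => e e0.
have C0 : 0 < 2 * (nrm x ^+ 2 + 1) by rewrite mulr_gt0 // ltr_wpDl ?sqr_ge0.
have d0 := divr_gt0 e0 C0; set d := e / _ in d0.
have dE : d * (2 * (nrm x ^+ 2 + 1)) = e by rewrite divfK // gt_eqF.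
have [dA dA0 hdA] := op_pow_cont r hA d0; have [dB dB0 hdB] := op_pow_cont r hB d0.
pose h := Num.min dA dB; have h0 : 0 < h by rewrite lt_min dA0.
(* The dyadic number s below r with denominator N lies within h of r. *)
pose n := Num.truncn h^-1; pose N : R := 2 ^+ n.
have N0 : 0 < N by rewrite exprn_gt0.
have Nh : N^-1 <= h.
  rewrite invf_ple ?posrE // (le_trans (ltW (truncnS_gt _))) //.
  by rewrite /N -natrX ler_nat -/n ltn_expl.
pose k := Num.truncn (r * N); pose s : R := k%:R / N.
have rN0 : 0 <= r * N by rewrite mulr_ge0 // ltW.
have k1 : k%:R <= r * N by rewrite truncn_le.
have k2 : r * N < k.+1%:R by exact: truncnS_gt.
have kn : (k <= 2 ^ n)%N.
  by rewrite -(ler_nat R) natrX (le_trans k1) // ler_piMl // ltW.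
have sr : `|s - r| <= h.
  rewrite (le_trans _ Nh) // distrC ger0_norm.
    rewrite -(ler_pM2r N0) mulVf ?gt_eqF // mulrBl /s divfK ?gt_eqF //.
    by rewrite lerBlDl natr1 ltW.
  by rewrite subr_ge0 /s ler_pdivrMr.
have hA' : `|s - r| <= dA by rewrite (le_trans sr) // ge_min lexx.
have hB' : `|s - r| <= dB by rewrite (le_trans sr) // ge_min lexx orbT.
have := hdA s x hA'; have := hdB s x hB'; rewrite !ler_norml.
have hs := form_ge_dyadic hA hB AB kn x.
exact: (arith _ _ _ _ _ _ _ d0 dE hs).
Qed.

(** Expand <T (z - y), z - y> >= 0 at z = T^(-1) x and y = S^(-1) x. *)
Lemma form_ge_inv S S' T T' : linear T -> form_sym T -> (forall x, 0 <= ip (T x) x) ->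
  (forall x, S (S' x) = x) -> (forall x, T (T' x) = x) -> form_ge S T -> form_ge T' S'.
Proof.
move=> lT sT T0 hS hT ST x.
have := T0 (T' x - S' x); rewrite (linB lT) hT !ipE (sT _ (T' x)) hT.
have := ST (S' x); rewrite hS (ipC (S' x)) (ipC (T' x)) (ipC x (S' x)); lra.
Qed.

(** For exponents k/(n+1) the law (B^s)^t = B^(s t) follows from uniqueness of
roots: B^(s/(n+1)) is a root of B^s. *)
Lemma op_pow_pow_frac B s n k : pd B ->
  op_pow (op_pow B s) (k%:R / n.+1%:R) = op_pow B (s * (k%:R / n.+1%:R)).
Proof.
move=> hB; have hs := op_pow_pd s hB.
have e : op_pow (op_pow B s) n.+1%:R^-1 = op_pow B (s / n.+1%:R).
  rewrite -[RHS](op_pow_root n (op_pow_pd _ hB)); congr op_pow.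
  by apply/funext => x; rewrite iter_op_pow // mulrC divfK // pnatr_eq0.
apply/funext => x; rewrite -iter_op_pow // e iter_op_pow //; congr op_pow.
by rewrite mulrCA.
Qed.

(** * The power inequality and the operator equation *)

Lemma conj_cancel (V V' T : H -> H) : cancel V' V -> cancel V V' ->
  V \o (V' \o T \o V') \o V = T.
Proof. by move=> h h'; apply/funext => x /=; rewrite h h'. Qed.

Section FixedParameters.
Context (A B : H -> H) (hA : pd A) (hB : pd B) (r p0 p : R) (n : nat).

Let X := op_pow A (r / 2) \o op_pow B p0 \o op_pow A (r / 2).
Let Z := op_pow A (r / 2) \o op_pow B p \o op_pow A (r / 2).

Lemma sandwich_p0_pd : pd X. Proof. by apply: sandwich_pd; exact: op_pow_pd. Qed.
Lemma sandwich_p_pd : pd Z. Proof. by apply: sandwich_pd; exact: op_pow_pd. Qed.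

(** As X is self-adjoint, the form of X^2 at x is |X x|^2. *)
Lemma power_inequality_form : power_inequality dot A B r p0 p n <->
  forall x, ip (op_pow Z n.+1%:R^-1 x) x <= nrm (X x) ^+ 2.
Proof.
have e := op_ge_pd (iter_pd 2 sandwich_p0_pd) (op_pow_pd n.+1%:R^-1 sandwich_p_pd).
split.
  by move=> /e h x; rewrite (le_trans (h x)) //= (pd_form_sym sandwich_p0_pd) ipxx.
by move=> h; apply/e => x; rewrite (le_trans (h x)) //= (pd_form_sym sandwich_p0_pd) ipxx.
Qed.

(** An instance of (G G')^a = G (G' G)^(a-1) G', for a = 1/(n+1).  With W = G' G,
the (k+1)-st power of the right-hand side is G W^(k - (k+1) n/(n+1)) G', and the
exponent vanishes for k = n. *)
Lemma root_sandwich_swap : let W := op_pow B (p / 2) \o op_pow A r \o op_pow B (p / 2) in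
  op_pow Z n.+1%:R^-1 = op_pow A (r / 2) \o
   (op_pow B (p / 2) \o op_pow W (- (n%:R / n.+1%:R)) \o op_pow B (p / 2)) \o op_pow A (r / 2).
Proof.
move=> W; have hW : pd W by apply: sandwich_pd; exact: op_pow_pd.
set b := _ / _; set Y := RHS.
have hY : pd Y by do 2!(apply: sandwich_pd; last exact: op_pow_pd); exact: op_pow_pd.
suff -> : Z = iter n.+1 Y by rewrite op_pow_root.
have e k x : iter k.+1 Y x = op_pow A (r / 2) (op_pow B (p / 2)
    (op_pow W (k.+1%:R * - b + k%:R) (op_pow B (p / 2) (op_pow A (r / 2) x)))).
  elim: k => [|k IH]; first by rewrite mul1r addr0.
  rewrite iterS IH /Y /= (op_powD (r / 2) (r / 2)) // -splitr.
  rewrite -[op_pow B (p / 2) (op_pow A r (op_pow B (p / 2) _))]/(W _).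
  rewrite -(op_pow1 (op_pow W _ _) hW) !op_powD //.
  by congr (op_pow A _ (op_pow B _ (op_pow W _ _))); rewrite -!natr1; ring.
apply/funext => x; rewrite e mulrN /b mulrCA mulfV ?pnatr_eq0 // mulr1 addNr op_pow0 //.
by rewrite op_powD // -splitr.
Qed.

(** W >= B^(p+r) gives W^(-n/(n+1)) <= B^(-(p+r) n/(n+1)); the exponents add up to
2 p0 + r because of the relation between the parameters. *)
Lemma power_inequality_of_order : admissible r p0 p n -> form_ge A B -> power_inequality dot A B r p0 p n.
Proof.
case=> r01 _ padm AB; apply/power_inequality_form => x.
have ABr := lowner_heinz hA hB AB r01.
rewrite root_sandwich_swap; set W := op_pow B (p / 2) \o op_pow A r \o op_pow B (p / 2).
have hW : pd W by apply: sandwich_pd; exact: op_pow_pd.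
set b := n%:R / n.+1%:R.
have b01 : 0 <= b <= 1.
  by rewrite divr_ge0 ?ler0n //= ler_pdivrMr ?ltr0n // mul1r ler_nat.
have hWB : form_ge W (op_pow B (p + r)).
  move=> y; rewrite /W /= (op_pow_form_sym (p / 2) hB) (le_trans _ (ABr _)) //.
  rewrite -(op_pow_form_sym (p / 2) hB) !op_powD //.
  by rewrite (_ : p / 2 + r + p / 2 = p + r) //; field.
have hWb := lowner_heinz hW (op_pow_pd _ hB) hWB b01.
rewrite op_pow_pow_frac // in hWb.
have hinv : form_ge (op_pow B (- ((p + r) * b))) (op_pow W (- b)).
  apply: form_ge_inv hWb; [exact: op_pow_lin|exact: op_pow_form_sym| | | ].
  - by move=> y; exact: pd_ge0 (op_pow_pd _ hB).
  - by move=> y; rewrite op_powVK.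
  - by move=> y; rewrite op_powVK.
rewrite /= op_pow_form_sym // op_pow_form_sym // (le_trans (hinv _)) //.
rewrite -op_pow_form_sym // !op_powD //.
rewrite (_ : p / 2 - (p + r) * b + p / 2 = p0 + r + p0); last first.
  have hb : (p + r) * b = (p + r) - (2 * p0 + r + r).
    have c0 : n.+1%:R != 0 :> R by rewrite pnatr_eq0.
    rewrite /b (_ : n%:R = n.+1%:R - 1 :> R); last by rewrite -natr1 addrK.
    by rewrite padm; move: (n.+1%:R) c0 => c c0; field.
  by rewrite hb; lra.
rewrite -!op_powD // op_pow_form_sym // (le_trans (ABr _)) //.
by rewrite {1}(splitr r) -op_powD // op_pow_form_sym // -ipxx.
Qed.

Let K := op_pow A (r / 2) \o op_pow B p0 \o op_pow A r \o op_pow B p0 \o op_pow A (r / 2).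

Lemma K_square : K = X \o X.
Proof.
apply/funext => x; rewrite /K /X /=; congr (op_pow A _ (op_pow B _ _)).
by rewrite op_powD // -splitr.
Qed.

Lemma iter_shift (S : H -> H) (m : nat) x : iter m (S \o K) (S x) = S (iter m (K \o S) x).
Proof. by elim: m => //= m ->. Qed.

Lemma iter_XSX (S : H -> H) (m : nat) x :
  iter m.+1 (X \o S \o X) x = X (S (iter m (K \o S) (X x))).
Proof. by rewrite K_square; elim: m => //= m ->. Qed.

(** Multiplying by the invertible A^(r/2) on both sides turns the equation for B^p
into one for a power of X S X. *)
Lemma equation_iff_power (S : H -> H) :
  op_pow B p = op_pow B p0 \o op_pow A (r / 2) \o S \o iter n (K \o S) \o op_pow A (r / 2) \o op_pow B p0
  <-> iter n.+1 (X \o S \o X) = Z.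
Proof.
split=> e; apply/funext => x.
  rewrite iter_XSX /Z /= e /=.
  by rewrite /X /=.
have := congr1 (@^~ (op_pow A (- (r / 2)) x)) e; rewrite iter_XSX /Z /X /= op_powVK //.
by move=> /(congr1 (op_pow A (- (r / 2)))); rewrite !op_powK.
Qed.

Lemma equation_forms_agree (S : H -> H) :
  op_pow B p0 \o op_pow A (r / 2) \o iter n (S \o K) \o S \o op_pow A (r / 2) \o op_pow B p0
  = op_pow B p0 \o op_pow A (r / 2) \o S \o iter n (K \o S) \o op_pow A (r / 2) \o op_pow B p0.
Proof. by apply/funext => x /=; rewrite iter_shift. Qed.

(** Solutions of the equation are the S with X S X = Y, and the bound S <= 1 is
the inequality Y <= X^2 conjugated by X^(-1). *)
Lemma inequality_iff_solvable :
  power_inequality dot A B r p0 p n <-> operator_equation_solvable dot A B r p0 p n.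
Proof.
have hX := sandwich_p0_pd; have hZ := sandwich_p_pd.
pose Y := op_pow Z n.+1%:R^-1; have hY : pd Y := op_pow_pd _ hZ.
have root S : pd S -> iter n.+1 (X \o S \o X) = Z -> X \o S \o X = Y.
  by move=> hS e; rewrite /Y -e op_pow_root //; exact: sandwich_pd.
rewrite power_inequality_form; split.
- move=> h; pose X' := op_pow X (-1); have hX' : pd X' := op_pow_pd _ hX.
  have XX' x : X (X' x) = x by rewrite -[X _](op_pow1 _ hX) op_powVK.
  have X'X x : X' (X x) = x by have := op_powK 1 x hX; rewrite op_pow1.
  have hS : pd (X' \o Y \o X') by exact: sandwich_pd.
  exists (X' \o Y \o X'); split.
    have eS : iter n.+1 (X \o (X' \o Y \o X') \o X) = Z.
      apply: etrans (congr1 (iter n.+1) (conj_cancel Y XX' X'X)) _.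
      by apply/funext => x; exact: op_rootK.
    split=> //.
    + apply/(opnorm_leP ler01 (pd_bounded hS)); apply: form_between_opbound => //.
      split; [exact: pd_lin|exact: pd_form_sym| |] => x.
        by rewrite (@le_trans _ _ 0) ?pd_ge0 // mulN1r oppr_le0 sqr_ge0.
      by rewrite /= (pd_form_sym hX') (le_trans (h _)) // XX' mul1r.
    + exact/equation_iff_power.
    + by rewrite -/K equation_forms_agree; exact/equation_iff_power.
  move=> S [hS' _ /equation_iff_power e _].
  apply: etrans (conj_cancel S X'X XX').
  by congr (X' \o _ \o X'); rewrite (root S hS' e).
- case=> S [[hS nS /equation_iff_power e _] _] x; rewrite -/Y -(root S hS e) /=.
  have bS : opbound S 1 by apply/opnorm_leP => //; exact: pd_bounded.
  rewrite (pd_form_sym hX) (le_trans (ip_le _ _)) // expr2 ler_wpM2r ?nrm_ge0 //.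
  by rewrite (le_trans (bS _)) // mul1r.
Qed.

End FixedParameters.

(** The inequality at the vector A^(-1/2) y. *)
Lemma order_of_power_inequality A B : pd A -> pd B ->
  power_inequality dot A B 1 0 1 0 -> form_ge A B.
Proof.
move=> hA hB /(power_inequality_form hA hB) h y.
have hZ := sandwich_p_pd hA hB 1 1.
have := h (op_pow A (- (1 / 2)) y); rewrite /= invr1 op_pow1 // /= op_powVK // op_pow_form_sym // op_powVK //.
rewrite op_pow1 // op_pow0 // -ipxx.
by rewrite op_pow_half // op_pow1.
Qed.

End HilbertOperators.

Theorem theorem3p1 (R : realType) (H : completeNormedModType R[i])
    (dot : {dot H for (@Num.conj R[i])}) (hdot : induces_norm dot)
    (A B : H -> H)
    (hA : positive_definite dot A) (hB : positive_definite dot B) :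
  [/\ (op_ge dot A B /\ positive_definite dot B) <->
      (forall (r p0 p : R) (n : nat), admissible r p0 p n ->
         power_inequality dot A B r p0 p n),
      (op_ge dot A B /\ positive_definite dot B) <->
      (forall (r p0 p : R) (n : nat), admissible r p0 p n ->
         operator_equation_solvable dot A B r p0 p n) &
      (forall (r p0 p : R) (n : nat), admissible r p0 p n ->
         (power_inequality dot A B r p0 p n <->
          operator_equation_solvable dot A B r p0 p n))].
Proof.
have iff32_33 r p0 p n := inequality_iff_solvable hdot hA hB r p0 p n.
have iff31_32 : (op_ge dot A B /\ positive_definite dot B) <->
    (forall (r p0 p : R) (n : nat), admissible r p0 p n ->
       power_inequality dot A B r p0 p n).
  split=> [[/(op_ge_pd hA hB) AB _] r p0 p n adm|h]; first exact: power_inequality_of_order.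
  split=> //; apply/(op_ge_pd hA hB)/order_of_power_inequality => //.
  by apply: h; split; rewrite ?lexx ?ltr01 ?ler01 //; lra.
split=> //; apply: (iff_trans iff31_32); split=> h r p0 p n adm; exact/iff32_33/h.
Qed.
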